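(* There are ($k$-linear) triangulated categories $\mathbf{T}_1$, $\mathbf{T}_2$, a full subcategory $\mathbf{A}\subseteq\mathbf{T}_1$ spanned by a full strong exceptional sequence, and exact functors $F,G:\mathbf{T}_1\to\mathbf{T}_2$ such that $F|_{\mathbf{A}}\simeq G|_{\mathbf{A}}$ but $F\not\simeq G$.
   Context: $k$ is a fixed field; all categories and functors are $k$-linear. A full strong exceptional sequence in a triangulated category $\mathbf{T}$ is a finite sequence of objects $E_1,\dots,E_n$ with $\mathrm{Hom}(E_i,E_i)=k$ for all $i$, $\mathrm{Hom}(E_i,E_j[l])=0$ for all $i,j$ and $l\neq0$, $\mathrm{Hom}(E_i,E_j)=0$ for $i>j$, and such that the smallest strictly full triangulated subcategory containing all $E_i$ is $\mathbf{T}$. $\simeq$ denotes natural isomorphism of functors. *)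

(* Defs.v *)
From HB Require Import structures.
From mathcomp Require Import all_boot all_order all_algebra.

(* MathComp. No category theory is available in the library, so k-linear
   triangulated categories are set up here. *)

Set Implicit Arguments.
Unset Strict Implicit.
Unset Printing Implicit Defensive.

Import GRing.Theory.
Local Open Scope ring_scope.

Record linCat (k : fieldType) := LinCat {
  obj :> Type;
  hom : obj -> obj -> lmodType k;
  idm : forall X, hom X X;
  comp : forall X Y Z, hom Y Z -> hom X Y -> hom X Z;
  comp1m : forall X Y (f : hom X Y), comp (idm Y) f = f;
  compm1 : forall X Y (f : hom X Y), comp f (idm X) = f;
  compmA : forall W X Y Z (h : hom Y Z) (g : hom X Y) (f : hom W X),
    comp h (comp g f) = comp (comp h g) f;
  comp_linearr : forall X Y Z (g : hom Y Z),
    linear (fun f : hom X Y => comp g f);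
  comp_linearl : forall X Y Z (f : hom X Y),
    linear (fun g : hom Y Z => comp g f)
}.

Arguments hom {k C} X Y : rename.
Arguments idm {k C} X : rename.
Arguments comp {k C X Y Z} g f : rename.

Notation "g \oc f" := (comp g f) (at level 40, left associativity).

Definition is_iso (k : fieldType) (C : linCat k) (X Y : C) (f : hom X Y) : Prop :=
  exists g : hom Y X, g \oc f = idm X /\ f \oc g = idm Y.

Definition isomorphic (k : fieldType) (C : linCat k) (X Y : C) : Prop :=
  exists f : hom X Y, is_iso f.

(* Initial and terminal; a morphism always exists, namely 0. *)
Definition is_zero_obj (k : fieldType) (C : linCat k) (Z : C) : Prop :=
  forall X : C, (forall f g : hom Z X, f = g) /\ (forall f g : hom X Z, f = g).

Definition is_biproduct (k : fieldType) (C : linCat k) (X Y P : C)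
    (i1 : hom X P) (i2 : hom Y P) (p1 : hom P X) (p2 : hom P Y) : Prop :=
  [/\ p1 \oc i1 = idm X, p2 \oc i2 = idm Y, p1 \oc i2 = 0, p2 \oc i1 = 0
    & i1 \oc p1 + i2 \oc p2 = idm P].

Definition additive_cat (k : fieldType) (C : linCat k) : Prop :=
  (exists Z : C, is_zero_obj Z) /\
  (forall X Y : C, exists (P : C) (i1 : hom X P) (i2 : hom Y P)
     (p1 : hom P X) (p2 : hom P Y), is_biproduct i1 i2 p1 p2).

Record linFunctor (k : fieldType) (C D : linCat k) := LinFunctor {
  fobj :> C -> D;
  fmap : forall X Y : C, hom X Y -> hom (fobj X) (fobj Y);
  fmap_id : forall X : C, fmap (idm X) = idm (fobj X);
  fmap_comp : forall (X Y Z : C) (g : hom Y Z) (f : hom X Y),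
    fmap (g \oc f) = fmap g \oc fmap f;
  fmap_linear : forall X Y : C, linear (@fmap X Y)
}.

Arguments fmap {k C D} F {X Y} f : rename.

Definition idF (k : fieldType) (C : linCat k) : linFunctor C C :=
  @LinFunctor k C C id (fun _ _ => id) (fun _ => erefl) (fun _ _ _ _ _ => erefl)
    (fun _ _ _ _ _ => erefl).

Section CompF.
Context (k : fieldType) (C D E : linCat k).
Context (G : linFunctor D E) (F : linFunctor C D).

Lemma compF_id (X : C) : fmap G (fmap F (idm X)) = idm (G (F X)).
Proof. by rewrite !fmap_id. Qed.

Lemma compF_comp (X Y Z : C) (g : hom Y Z) (f : hom X Y) :
  fmap G (fmap F (g \oc f)) = fmap G (fmap F g) \oc fmap G (fmap F f).
Proof. by rewrite !fmap_comp. Qed.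

Lemma compF_linear (X Y : C) : linear (fun f : hom X Y => fmap G (fmap F f)).
Proof. by move=> a f g; rewrite !fmap_linear. Qed.

Definition compF : linFunctor C E :=
  LinFunctor compF_id compF_comp compF_linear.
End CompF.

Record natIso (k : fieldType) (C D : linCat k) (F G : linFunctor C D) := NatIso {
  nat_map :> forall X : C, hom (F X) (G X);
  nat_map_iso : forall X : C, is_iso (nat_map X);
  nat_map_natural : forall (X Y : C) (f : hom X Y),
    nat_map Y \oc fmap F f = fmap G f \oc nat_map X
}.

Definition nat_isomorphic (k : fieldType) (C D : linCat k)
    (F G : linFunctor C D) : Prop := inhabited (natIso F G).

Notation "F '\simeq' G" := (nat_isomorphic F G) (at level 70, no associativity).

Definition fullSub (k : fieldType) (C : linCat k) (P : C -> Prop) : linCat k :=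
  @LinCat k {X : C | P X} (fun X Y => hom (sval X) (sval Y))
    (fun X => idm (sval X)) (fun X Y Z g f => g \oc f)
    (fun X Y f => comp1m f) (fun X Y f => compm1 f)
    (fun W X Y Z h g f => compmA h g f)
    (fun X Y Z g => @comp_linearr k C (sval X) (sval Y) (sval Z) g)
    (fun X Y Z f => @comp_linearl k C (sval X) (sval Y) (sval Z) f).

Definition fullSub_incl (k : fieldType) (C : linCat k) (P : C -> Prop) :
    linFunctor (fullSub P) C :=
  @LinFunctor k (fullSub P) C sval (fun _ _ => id) (fun _ => erefl)
    (fun _ _ _ _ _ => erefl) (fun _ _ _ _ _ => erefl).

Definition restrict (k : fieldType) (C D : linCat k) (F : linFunctor C D)
    (P : C -> Prop) : linFunctor (fullSub P) D := compF F (fullSub_incl P).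

(* The shift X |-> X[1] is an autoequivalence; [unshift], X |-> X[-1], is a
   chosen quasi-inverse. [dist f g h] says that
   X --f--> Y --g--> Z --h--> X[1] is a distinguished triangle;
   [tr4] is the octahedral axiom. *)
Record triCat (k : fieldType) := TriCat {
  tri_cat :> linCat k;
  tri_additive : additive_cat tri_cat;
  shift : linFunctor tri_cat tri_cat;
  unshift : linFunctor tri_cat tri_cat;
  shift_unshift : natIso (compF shift unshift) (idF tri_cat);
  unshift_shift : natIso (compF unshift shift) (idF tri_cat);
  dist : forall X Y Z : tri_cat, hom X Y -> hom Y Z -> hom Z (shift X) -> Prop;
  tr1_id : forall X Z : tri_cat, is_zero_obj Z ->
    dist (idm X) (0 : hom X Z) (0 : hom Z (shift X));
  tr1_iso : forall (X Y Z X' Y' Z' : tri_cat)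
    (f : hom X Y) (g : hom Y Z) (h : hom Z (shift X))
    (f' : hom X' Y') (g' : hom Y' Z') (h' : hom Z' (shift X'))
    (a : hom X X') (b : hom Y Y') (c : hom Z Z'),
    is_iso a -> is_iso b -> is_iso c ->
    b \oc f = f' \oc a -> c \oc g = g' \oc b -> fmap shift a \oc h = h' \oc c ->
    dist f g h -> dist f' g' h';
  tr1_cone : forall (X Y : tri_cat) (f : hom X Y),
    exists (Z : tri_cat) (g : hom Y Z) (h : hom Z (shift X)), dist f g h;
  tr2 : forall (X Y Z : tri_cat)
    (f : hom X Y) (g : hom Y Z) (h : hom Z (shift X)),
    dist f g h <-> dist g h (- fmap shift f);
  tr3 : forall (X Y Z X' Y' Z' : tri_cat)
    (f : hom X Y) (g : hom Y Z) (h : hom Z (shift X))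
    (f' : hom X' Y') (g' : hom Y' Z') (h' : hom Z' (shift X'))
    (a : hom X X') (b : hom Y Y'),
    dist f g h -> dist f' g' h' -> b \oc f = f' \oc a ->
    exists c : hom Z Z', c \oc g = g' \oc b /\ fmap shift a \oc h = h' \oc c;
  tr4 : forall (X Y Z X' Y' Z' : tri_cat) (f : hom X Y) (g : hom Y Z)
    (f1 : hom Y Z') (f2 : hom Z' (shift X))
    (g1 : hom Z X') (g2 : hom X' (shift Y))
    (e1 : hom Z Y') (e2 : hom Y' (shift X)),
    dist f f1 f2 -> dist g g1 g2 -> dist (g \oc f) e1 e2 ->
    exists (u : hom Z' Y') (v : hom Y' X'),
      [/\ dist u v (fmap shift f1 \oc g2),
          u \oc f1 = e1 \oc g, e2 \oc u = f2,
          v \oc e1 = g1 & g2 \oc v = fmap shift f \oc e2]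
}.

Arguments shift {k} T : rename.
Arguments unshift {k} T : rename.
Arguments dist {k T X Y Z} f g h : rename.

Definition shiftz (k : fieldType) (T : triCat k) (X : T) (l : int) : T :=
  match l with
  | Posz n => iter n (shift T) X
  | Negz n => iter n.+1 (unshift T) X
  end.

Record exactFunctor (k : fieldType) (S T : triCat k) := ExactFunctor {
  exact_fun :> linFunctor S T;
  exact_shift : natIso (compF exact_fun (shift S)) (compF (shift T) exact_fun);
  exact_dist : forall (X Y Z : S)
    (f : hom X Y) (g : hom Y Z) (h : hom Z (shift S X)),
    dist f g h ->
    dist (fmap exact_fun f) (fmap exact_fun g) (exact_shift X \oc fmap exact_fun h)
}.

(* Being closed under direct sums and under the two other two-out-of-three
   conditions follows. *)
Definition strictly_full_tri_sub (k : fieldType) (T : triCat k)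
    (P : T -> Prop) : Prop :=
  [/\ forall X Y : T, isomorphic X Y -> P X -> P Y,
      forall Z : T, is_zero_obj Z -> P Z,
      forall X : T, P X -> P (shift T X),
      forall X : T, P X -> P (unshift T X)
    & forall (X Y Z : T) (f : hom X Y) (g : hom Y Z) (h : hom Z (shift T X)),
        dist f g h -> P X -> P Y -> P Z].

Definition tri_generated (k : fieldType) (T : triCat k) (n : nat)
    (E : 'I_n -> T) (X : T) : Prop :=
  forall P : T -> Prop,
    strictly_full_tri_sub P -> (forall i, P (E i)) -> P X.

Definition full_strong_exceptional (k : fieldType) (T : triCat k) (n : nat)
    (E : 'I_n -> T) : Prop :=
  [/\ (* Hom(E_i, E_i) = k, via the structure map of the k-algebra End(E_i) *)
      forall i, bijective (fun a : k => a *: idm (E i)),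
      forall (i j : 'I_n) (l : int), l != 0 ->
        forall f : hom (E i) (shiftz (E j) l), f = 0,
      forall i j : 'I_n, (j < i)%N -> forall f : hom (E i) (E j), f = 0
    & forall X : T, tri_generated E X].

Definition spanned (k : fieldType) (C : linCat k) (n : nat) (E : 'I_n -> C)
    (X : C) : Prop := exists i, X = E i.

(* Main.v *)
(* The source and target are both the bounded homotopy category of the path category
   P_0 -> P_1 -> P_2 of the linear A_3 quiver, i.e. D^b(A_3).  The sequence
   P_0, P_2, Cone (P_1 -> P_2) is strongly exceptional with composite
   P_0 -> P_2 -> Cone (P_1 -> P_2) equal to zero, and it does not see the map
   P_0 -> P_1, which only arises from a choice of null-homotopy of that composite.
   Filtered complexes admit an exact functor for every partition of {0, 1, 2} into
   intervals, namely passing to the associated graded of the coarser filtration.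
   The partitions {0, 1} {2} and {0} {1} {2} give functors that agree on the exceptional
   sequence, but the first one preserves P_0 -> P_1 and the second one kills it. *)

Require Import Defs.
From HB Require Import structures.
From mathcomp Require Import all_boot all_order all_algebra.

Set Implicit Arguments.
Unset Strict Implicit.
Unset Printing Implicit Defensive.

Import Order.TTheory GRing.Theory Num.Theory.
(* MathComp's [hom] (vector) would otherwise shadow the one of [linCat]. *)
Import Defs.
Local Open Scope ring_scope.

Local Arguments Defs.comp : simpl never.
Local Arguments Defs.idm : simpl never.

(* [(d, p)] is the grade of a copy of P_p in cohomological degree d. *)
Definition grade : Type := (int * 'I_3)%type.

Definition grade_rel (e : int) (y x : grade) : bool :=
  (y.1 == x.1 + e) && (x.2 <= y.2)%N.

(** * Graded matrices and complexes *)

Section GradedMatrices.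
Variable k : fieldType.

Definition gr_cat m n (g : 'I_m -> grade) (h : 'I_n -> grade) : 'I_(m + n) -> grade :=
  fun i => match split i with inl a => g a | inr b => h b end.

Lemma gr_catl m n (g : 'I_m -> grade) (h : 'I_n -> grade) i :
  gr_cat g h (lshift n i) = g i.
Proof.
by rewrite /gr_cat; case: split_ordP => j /eqP; rewrite ?eq_lrshift ?eq_shift // => /eqP ->.
Qed.

Lemma gr_catr m n (g : 'I_m -> grade) (h : 'I_n -> grade) i :
  gr_cat g h (rshift m i) = h i.
Proof.
by rewrite /gr_cat; case: split_ordP => j /eqP; rewrite ?eq_rlshift ?eq_shift // => /eqP ->.
Qed.

Definition homog e m n (g : 'I_m -> grade) (h : 'I_n -> grade) (M : 'M[k]_(m, n)) : Prop :=
  forall i j, ~~ grade_rel e (g i) (h j) -> M i j = 0.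

Definition trunc (R : rel grade) m n (g : 'I_m -> grade) (h : 'I_n -> grade)
  (M : 'M[k]_(m, n)) : 'M[k]_(m, n) :=
  \matrix_(i, j) if R (g i) (h j) then M i j else 0.

Section Basic.
Variables (m n : nat) (g : 'I_m -> grade) (h : 'I_n -> grade).
Implicit Types M N : 'M[k]_(m, n).

Lemma trunc_linear R : linear (@trunc R m n g h).
Proof. by move=> a M N; apply/matrixP=> i j; rewrite !mxE; case: ifP; rewrite ?mulr0 ?addr0. Qed.

HB.instance Definition _ R := GRing.isLinear.Build k 'M[k]_(m, n) 'M[k]_(m, n) _
  (@trunc R m n g h) (trunc_linear R).

Lemma homogP e M : homog e g h M <-> trunc (grade_rel e) g h M = M.
Proof.
split=> [hM | <- i j]; last by rewrite mxE => /negPf ->.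
by apply/matrixP=> i j; rewrite mxE; case: ifPn => // /hM ->.
Qed.

Lemma trunc_homog e M : homog e g h (trunc (grade_rel e) g h M).
Proof. by move=> i j; rewrite mxE => /negPf ->. Qed.

Lemma homog_trunc R e M : homog e g h M -> homog e g h (trunc R g h M).
Proof. by move=> hM i j /hM; rewrite mxE => ->; rewrite if_same. Qed.

Lemma homog0 e : homog e g h 0. Proof. by move=> i j _; rewrite mxE. Qed.

Lemma homogD e M N : homog e g h M -> homog e g h N -> homog e g h (M + N).
Proof. by move=> hM hN i j ne; rewrite mxE hM // hN // addr0. Qed.

Lemma homogN e M : homog e g h M -> homog e g h (- M).
Proof. by move=> hM i j ne; rewrite mxE hM // oppr0. Qed.

Lemma homogZ e a M : homog e g h M -> homog e g h (a *: M).
Proof. by move=> hM i j ne; rewrite mxE hM // mulr0. Qed.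
End Basic.

Lemma homogM e1 e2 e m n p (g : 'I_m -> grade) (h : 'I_n -> grade) (l : 'I_p -> grade)
    (M : 'M[k]_(m, n)) (N : 'M[k]_(n, p)) :
  homog e1 g h M -> homog e2 h l N -> e = e1 + e2 -> homog e g l (M *m N).
Proof.
move=> hM hN -> i j ne; rewrite mxE big1 // => t _.
have [r1|/hM->] := boolP (grade_rel e1 (g i) (h t)); last by rewrite mul0r.
have [r2|/hN->] := boolP (grade_rel e2 (h t) (l j)); last by rewrite mulr0.
case/negP: ne; move: r1 r2 => /andP[/eqP d1 p1] /andP[/eqP d2 p2].
by rewrite /grade_rel d1 d2 (leq_trans p2 p1) andbT -addrA (addrC e2).
Qed.

Lemma homog1 m (g h : 'I_m -> grade) : g =1 h -> homog 0 g h 1%:M.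
Proof.
move=> gh i j; rewrite mxE gh; case: eqP => // ->.
by rewrite /grade_rel addr0 eqxx leqnn.
Qed.

Section Blocks.
Variables (e : int) (m1 m2 n1 n2 : nat).
Variables (g1 : 'I_m1 -> grade) (g2 : 'I_m2 -> grade).
Variables (h1 : 'I_n1 -> grade) (h2 : 'I_n2 -> grade).

Lemma homog_row m (g : 'I_m -> grade) (A : 'M[k]_(m, n1)) (B : 'M[k]_(m, n2)) :
  homog e g h1 A -> homog e g h2 B -> homog e g (gr_cat h1 h2) (row_mx A B).
Proof.
move=> hA hB i j; case: (split_ordP j) => t ->.
  by rewrite gr_catl row_mxEl; apply: hA.
by rewrite gr_catr row_mxEr; apply: hB.
Qed.

Lemma homog_col n (h : 'I_n -> grade) (A : 'M[k]_(m1, n)) (B : 'M[k]_(m2, n)) :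
  homog e g1 h A -> homog e g2 h B -> homog e (gr_cat g1 g2) h (col_mx A B).
Proof.
move=> hA hB i j; case: (split_ordP i) => t ->.
  by rewrite gr_catl col_mxEu; apply: hA.
by rewrite gr_catr col_mxEd; apply: hB.
Qed.
End Blocks.

Lemma homog_block e m1 m2 n1 n2
    (g1 : 'I_m1 -> grade) (g2 : 'I_m2 -> grade)
    (h1 : 'I_n1 -> grade) (h2 : 'I_n2 -> grade) A B C D :
  homog e g1 h1 A -> homog e g1 h2 B -> homog e g2 h1 C -> homog e g2 h2 D ->
  homog e (gr_cat g1 g2) (gr_cat h1 h2) (block_mx A B C D).
Proof. by move=> *; rewrite block_mxEv; apply: homog_col; apply: homog_row. Qed.

Definition gr_shift (l : int) n (g : 'I_n -> grade) : 'I_n -> grade :=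
  fun i => ((g i).1 + l, (g i).2).

Lemma homog_shift l e m n (g : 'I_m -> grade) (h : 'I_n -> grade) (M : 'M[k]_(m, n)) :
  homog e (gr_shift l g) (gr_shift l h) M <-> homog e g h M.
Proof.
have E i j : grade_rel e (gr_shift l g i) (gr_shift l h j) = grade_rel e (g i) (h j).
  by rewrite /grade_rel /= addrAC (inj_eq (addIr l)).
by split=> hM i j ne; apply: hM; rewrite ?E // -E.
Qed.
End GradedMatrices.

Section Complexes.
Variable k : fieldType.

(* A complex of direct sums of the P_p: since Hom(P_p, P_q) is k for p <= q and 0
   otherwise, a matrix of morphisms is a matrix over k with prescribed zeros.  Asking the
   differential to be strictly triangular makes every complex an iterated cone of stalks. *)
Record cplx := Cplx {
  sz : nat;
  gd : 'I_sz -> grade;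
  df : 'M[k]_sz;
  df_homog : homog 1 gd gd df;
  df_sq : df *m df = 0;
  df_tri : forall i j : 'I_sz, (j <= i)%N -> df i j = 0
}.
Arguments gd : clear implicits.
Arguments df : clear implicits.

Definition chain (X Y : cplx) (f : 'M[k]_(sz Y, sz X)) : Prop :=
  homog 0 (gd Y) (gd X) f /\ df Y *m f = f *m df X.

Definition htp (X Y : cplx) (f : 'M[k]_(sz Y, sz X)) : Prop :=
  exists2 h : 'M[k]_(sz Y, sz X), homog (-1) (gd Y) (gd X) h
    & f = df Y *m h + h *m df X.

Section HomSpace.
Variables X Y : cplx.
Local Notation V := 'M[k]_(sz Y, sz X).

Definition dcomm (f : V) : V := df Y *m f - f *m df X.
Lemma dcomm_linear : linear dcomm.
Proof.
by move=> a f g; rewrite /dcomm mulmxDl mulmxDr -scalemxAl -scalemxAr scalerBr opprD addrACA.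
Qed.
HB.instance Definition _ := GRing.isLinear.Build k V V _ dcomm dcomm_linear.

Definition off_degree (f : V) : V := trunc (grade_rel 0) (gd Y) (gd X) f - f.
Lemma off_degree_linear : linear off_degree.
Proof.
by move=> a f g; rewrite /off_degree linearP scalerBr opprD addrACA.
Qed.
HB.instance Definition _ := GRing.isLinear.Build k V V _ off_degree off_degree_linear.

Definition dhtp (h : V) : V :=
  let h' := trunc (grade_rel (-1)) (gd Y) (gd X) h in df Y *m h' + h' *m df X.
Lemma dhtp_linear : linear dhtp.
Proof.
move=> a f g; rewrite /dhtp /= linearP mulmxDl mulmxDr -scalemxAl -scalemxAr scalerDr.
by rewrite addrACA.
Qed.
HB.instance Definition _ := GRing.isLinear.Build k V V _ dhtp dhtp_linear.

Definition chain_space : {vspace V} := (lker (linfun off_degree) :&: lker (linfun dcomm))%VS.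
Definition htp_space : {vspace V} := (linfun dhtp @: fullv)%VS.

Lemma mem_chain_space f : reflect (chain f) (f \in chain_space).
Proof.
rewrite memv_cap !memv_ker !lfunE /= /off_degree /dcomm !subr_eq0.
by apply: (iffP andP) => [[/eqP/homogP a /eqP b]|[/homogP/eqP a /eqP b]].
Qed.

Lemma mem_htp_space f : reflect (htp f) (f \in htp_space).
Proof.
apply: (iffP memv_imgP) => [[h _ ->]|[h /homogP hh ->]].
  by rewrite lfunE /=; exists (trunc (grade_rel (-1)) (gd Y) (gd X) h) => //; apply: trunc_homog.
by exists h; rewrite ?memvf // lfunE /= /dhtp hh.
Qed.

(* The quotient of chain maps by null-homotopic ones, realised as a complement. *)
Definition Hm : lmodType k := subvs_of (chain_space :\: htp_space)%VS.

Definition cls (f : V) : Hm :=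
  vsproj (chain_space :\: htp_space)%VS (addv_pi1 chain_space htp_space f).
Definition rep (x : Hm) : V := vsval x.

Lemma cls_linear : linear cls.
Proof. by move=> a f g; rewrite /cls linearP linearP. Qed.

Lemma rep_chain x : chain (rep x).
Proof.
apply/mem_chain_space; have := subvsP x; apply: subvP; exact: diffvSl.
Qed.

Lemma repK x : cls (rep x) = x.
Proof.
apply: subvs_inj; rewrite /cls /rep /addv_pi1 daddv_pi_id ?capv_diff ?subvsP // vsprojK //.
exact: subvsP.
Qed.

Lemma htp_cls0 f : htp f -> cls f = 0.
Proof.
move/mem_htp_space => fB; rewrite /cls.
suff -> : addv_pi1 chain_space htp_space f = 0 by rewrite linear0.
have fZB : f \in (chain_space + htp_space)%VS by rewrite (subvP (addvSr _ _)).
have := addv_pi1_pi2 fZB; rewrite addv_pi2_id // => /eqP.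
by rewrite -subr_eq0 addrK => /eqP.
Qed.

Lemma cls0_htp f : chain f -> cls f = 0 -> htp f.
Proof.
move/mem_chain_space => fZ /(congr1 (@vsval _ _ _)).
rewrite /cls vsprojK ?memv_pi1 //; last exact: memv_pi.
move=> f0; have fZB : f \in (chain_space + htp_space)%VS by rewrite (subvP (addvSl _ _)).
apply/mem_htp_space; rewrite -(addv_pi1_pi2 fZB) f0 /= add0r; exact: memv_pi2.
Qed.
End HomSpace.
End Complexes.

(** * The homotopy category *)

Section HomotopyCategory.
Variable k : fieldType.
Implicit Types X Y Z W : cplx k.

Lemma chain1 X : chain (1%:M : 'M[k]_(sz X, sz X)).
Proof. by split; [exact: homog1 | rewrite mulmx1 mul1mx]. Qed.

Lemma chainD X Y (f g : 'M[k]_(sz Y, sz X)) : chain f -> chain g -> chain (f + g).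
Proof.
by move=> [hf cf] [hg cg]; split; [exact: homogD | rewrite mulmxDl mulmxDr cf cg].
Qed.

Lemma chainN X Y (f : 'M[k]_(sz Y, sz X)) : chain f -> chain (- f).
Proof. by move=> [hf cf]; split; [exact: homogN | rewrite mulmxN mulNmx cf]. Qed.

Lemma chainB X Y (f g : 'M[k]_(sz Y, sz X)) : chain f -> chain g -> chain (f - g).
Proof. by move=> cf cg; apply: chainD => //; apply: chainN. Qed.

Lemma chainZ X Y a (f : 'M[k]_(sz Y, sz X)) : chain f -> chain (a *: f).
Proof. by move=> [hf cf]; split; [exact: homogZ | rewrite -scalemxAl -scalemxAr cf]. Qed.

Lemma chainM X Y Z (g : 'M[k]_(sz Z, sz Y)) (f : 'M[k]_(sz Y, sz X)) :
  chain g -> chain f -> chain (g *m f).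
Proof.
move=> [hg cg] [hf cf]; split; first by apply: (homogM hg hf).
by rewrite mulmxA cg -!mulmxA cf.
Qed.

Lemma htp0 X Y : htp (0 : 'M[k]_(sz Y, sz X)).
Proof. by exists 0; [exact: homog0 | rewrite mulmx0 mul0mx addr0]. Qed.

Lemma htpMl X Y Z (g : 'M[k]_(sz Z, sz Y)) (f : 'M[k]_(sz Y, sz X)) :
  chain g -> htp f -> htp (g *m f).
Proof.
move=> [hg cg] [h hh ->]; exists (g *m h); first by apply: (homogM hg hh).
by rewrite mulmxDr !mulmxA cg.
Qed.

Lemma htpMr X Y Z (g : 'M[k]_(sz Z, sz Y)) (f : 'M[k]_(sz Y, sz X)) :
  htp g -> chain f -> htp (g *m f).
Proof.
move=> [h hh ->] [hf cf]; exists (h *m f); first by apply: (homogM hh hf).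
by rewrite mulmxDl -!mulmxA cf.
Qed.

Lemma clsD X Y (f g : 'M[k]_(sz Y, sz X)) : @cls k X Y (f + g) = cls f + cls g.
Proof. by have := cls_linear 1 f g; rewrite !scale1r. Qed.

Lemma cls0 X Y : @cls k X Y 0 = 0.
Proof. exact/htp_cls0/htp0. Qed.

Lemma clsZ X Y a (f : 'M[k]_(sz Y, sz X)) : @cls k X Y (a *: f) = a *: cls f.
Proof. by rewrite -[a *: f]addr0 cls_linear cls0 addr0. Qed.

Lemma clsN X Y (f : 'M[k]_(sz Y, sz X)) : @cls k X Y (- f) = - cls f.
Proof. by rewrite -[- f]scaleN1r clsZ scaleN1r. Qed.

Lemma clsB X Y (f g : 'M[k]_(sz Y, sz X)) : @cls k X Y (f - g) = cls f - cls g.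
Proof. by rewrite clsD clsN. Qed.

Lemma htp_cls X Y (f g : 'M[k]_(sz Y, sz X)) : htp (f - g) -> @cls k X Y f = cls g.
Proof. by move/htp_cls0/eqP; rewrite clsB subr_eq0 => /eqP. Qed.

Lemma cls_htp X Y (f g : 'M[k]_(sz Y, sz X)) :
  chain f -> chain g -> @cls k X Y f = cls g -> htp (f - g).
Proof.
by move=> cf cg e; apply: cls0_htp; [exact: chainB | rewrite clsB e subrr].
Qed.

Lemma clsP X Y (x : Hm X Y) : exists2 f, chain f & x = cls f.
Proof. by exists (rep x); [exact: rep_chain | rewrite repK]. Qed.

Definition hcomp X Y Z (y : Hm Y Z) (x : Hm X Y) : Hm X Z := cls (rep y *m rep x).

Lemma hcompE X Y Z (g : 'M[k]_(sz Z, sz Y)) (f : 'M[k]_(sz Y, sz X)) :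
  chain g -> chain f -> @hcomp X Y Z (cls g) (cls f) = cls (g *m f).
Proof.
move=> cg cf; apply: htp_cls.
have hg : htp (rep (cls g : Hm Y Z) - g).
  by apply: cls_htp => //; rewrite ?repK //; apply: rep_chain.
have hf : htp (rep (cls f : Hm X Y) - f).
  by apply: cls_htp => //; rewrite ?repK //; apply: rep_chain.
set g' := rep _ in hg *; set f' := rep _ in hf *.
have -> : g' *m f' - g *m f = (g' - g) *m f' + g *m (f' - f).
  by rewrite mulmxBl mulmxBr addrA subrK.
have [h1 H1 ->] := htpMr hg (rep_chain (cls f)).
have [h2 H2 ->] := htpMl cg hf.
exists (h1 + h2); first exact: homogD.
by rewrite mulmxDl mulmxDr addrACA.
Qed.

Lemma hcomp1m X Y (f : Hm X Y) : hcomp (cls 1%:M) f = f.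
Proof. by have [g cg ->] := clsP f; rewrite hcompE ?mul1mx //; exact: chain1. Qed.

Lemma hcompm1 X Y (f : Hm X Y) : hcomp f (cls 1%:M) = f.
Proof. by have [g cg ->] := clsP f; rewrite hcompE ?mulmx1 //; exact: chain1. Qed.

Lemma hcompA W X Y Z (h : Hm Y Z) (g : Hm X Y) (f : Hm W X) :
  hcomp h (hcomp g f) = hcomp (hcomp h g) f.
Proof.
have [h' ch ->] := clsP h; have [g' cg ->] := clsP g; have [f' cf ->] := clsP f.
by rewrite !hcompE ?mulmxA //; apply: chainM.
Qed.

Lemma hcomp_linearr X Y Z (g : Hm Y Z) : linear (fun f : Hm X Y => hcomp g f).
Proof.
move=> a u v; have [g' cg ->] := clsP g.
have [u' cu ->] := clsP u; have [v' cv ->] := clsP v.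
rewrite -cls_linear !hcompE //; last by apply: chainD => //; apply: chainZ.
by rewrite mulmxDr -scalemxAr cls_linear.
Qed.

Lemma hcomp_linearl X Y Z (f : Hm X Y) : linear (fun g : Hm Y Z => hcomp g f).
Proof.
move=> a u v; have [f' cf ->] := clsP f.
have [u' cu ->] := clsP u; have [v' cv ->] := clsP v.
rewrite -cls_linear !hcompE //; last by apply: chainD => //; apply: chainZ.
by rewrite mulmxDl -scalemxAl cls_linear.
Qed.

Definition hCat : linCat k :=
  LinCat hcomp1m hcompm1 hcompA hcomp_linearr hcomp_linearl.

Definition cl (X Y : hCat) (f : 'M[k]_(sz Y, sz X)) : hom X Y := cls f.

Lemma comp_cl (X Y Z : hCat) (g : 'M[k]_(sz Z, sz Y)) (f : 'M[k]_(sz Y, sz X)) :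
  chain g -> chain f -> cl g \oc cl f = cl (g *m f).
Proof. exact: hcompE. Qed.

Lemma idm_cl (X : hCat) : idm X = cl 1%:M. Proof. by []. Qed.

Lemma clP (X Y : hCat) (x : hom X Y) : exists2 f, chain f & x = cl f.
Proof. exact: clsP. Qed.

Lemma htp_cl (X Y : hCat) (f g : 'M[k]_(sz Y, sz X)) :
  htp (f - g) -> cl f = cl g :> hom X Y.
Proof. exact: htp_cls. Qed.

Lemma is_iso_cl (X Y : hCat) (f : 'M[k]_(sz Y, sz X)) (g : 'M[k]_(sz X, sz Y)) :
  chain f -> chain g -> htp (g *m f - 1%:M) -> htp (f *m g - 1%:M) ->
  is_iso (cl f : hom X Y).
Proof.
move=> cf cg h1 h2; exists (cl g).
by rewrite !comp_cl // !idm_cl; split; apply: htp_cls.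
Qed.

Lemma is_iso_cl1 (X Y : hCat) (f : 'M[k]_(sz Y, sz X)) (g : 'M[k]_(sz X, sz Y)) :
  chain f -> chain g -> g *m f = 1%:M -> f *m g = 1%:M ->
  is_iso (cl f : hom X Y).
Proof.
by move=> cf cg e1 e2; apply: (is_iso_cl cf cg); rewrite ?e1 ?e2 subrr; exact: htp0.
Qed.

Definition zeroC : hCat.
Proof.
refine (@Cplx k 0 (fun=> (0, ord0)) 0 _ _ _).
- exact: homog0.
- exact: mul0mx.
- by move=> i j _; rewrite mxE.
Defined.

Definition dsumC (X Y : hCat) : hCat.
Proof.
refine (@Cplx k (sz X + sz Y) (gr_cat (@gd k X) (@gd k Y))
  (block_mx (df X) 0 0 (df Y)) _ _ _).
- by apply: homog_block; try exact: homog0; apply: df_homog.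
- by rewrite mulmx_block !mulmx0 !mul0mx !df_sq !addr0 block_mx0.
- move=> i j; case: (split_ordP i) => a ->; case: (split_ordP j) => b -> /=.
  + by rewrite block_mxEul; apply: df_tri.
  + by rewrite block_mxEur mxE.
  + by rewrite block_mxEdl mxE.
  + by rewrite block_mxEdr leq_add2l; apply: df_tri.
Defined.

Lemma hCat_additive : additive_cat hCat.
Proof.
split.
  exists zeroC => X; split=> f g.
    have [f' _ ->] := clP f; have [g' _ ->] := clP g.
    by rewrite [f']thinmx0 [g']thinmx0.
  have [f' _ ->] := clP f; have [g' _ ->] := clP g.
  by rewrite [f']flatmx0 [g']flatmx0.
move=> X Y; exists (dsumC X Y).
have c1 : @chain k X (dsumC X Y) (col_mx 1%:M 0).
  split; first by apply: homog_col; [exact: homog1 | exact: homog0].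
  by rewrite mul_block_col mul_col_mx !mulmx0 !mul0mx mulmx1 mul1mx !addr0.
have c2 : @chain k Y (dsumC X Y) (col_mx 0 1%:M).
  split; first by apply: homog_col; [exact: homog0 | exact: homog1].
  by rewrite mul_block_col mul_col_mx !mulmx0 !mul0mx mulmx1 mul1mx !add0r.
have c3 : @chain k (dsumC X Y) X (row_mx 1%:M 0).
  split; first by apply: homog_row; [exact: homog1 | exact: homog0].
  by rewrite mul_row_block mul_mx_row !mulmx0 !mul0mx mulmx1 mul1mx !addr0.
have c4 : @chain k (dsumC X Y) Y (row_mx 0 1%:M).
  split; first by apply: homog_row; [exact: homog0 | exact: homog1].
  by rewrite mul_row_block mul_mx_row !mulmx0 !mul0mx mulmx1 mul1mx !add0r.
exists (@cl X (dsumC X Y) (col_mx 1%:M 0)), (@cl Y (dsumC X Y) (col_mx 0 1%:M)),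
       (@cl (dsumC X Y) X (row_mx 1%:M 0)), (@cl (dsumC X Y) Y (row_mx 0 1%:M)).
split; rewrite !comp_cl ?idm_cl //.
- by rewrite mul_row_col mulmx1 mulmx0 addr0.
- by rewrite mul_row_col mulmx1 mulmx0 add0r.
- by rewrite mul_row_col mulmx0 mul0mx addr0 /cl cls0.
- by rewrite mul_row_col mulmx0 mul0mx addr0 /cl cls0.
- rewrite /cl -clsD !mul_col_row !(mulmx1, mulmx0) add_block_mx !add0r !addr0.
  by rewrite -scalar_mx_block.
Qed.

End HomotopyCategory.

(** * Shifts and mapping cones *)

Section InducedFunctor.
Variables (k : fieldType) (ob : cplx k -> cplx k).
Variable mp : forall X Y : cplx k, 'M[k]_(sz Y, sz X) -> 'M[k]_(sz (ob Y), sz (ob X)).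
Hypothesis mp_linear : forall X Y, linear (@mp X Y).
Hypothesis mp1 : forall X, mp 1%:M = 1%:M :> 'M_(sz (ob X), sz (ob X)).
Hypothesis mpM : forall X Y Z (g : 'M_(sz Z, sz Y)) (f : 'M_(sz Y, sz X)),
  chain g -> chain f -> mp (g *m f) = mp g *m mp f.
Hypothesis mp_chain : forall X Y (f : 'M_(sz Y, sz X)), chain f -> chain (mp f).
Hypothesis mp_htp : forall X Y (f : 'M_(sz Y, sz X)), htp f -> htp (mp f).

Definition ind_map (X Y : hCat k) (f : hom X Y) : hom (ob X : hCat k) (ob Y) :=
  cl (mp (rep f)).

Lemma ind_map_cl (X Y : hCat k) (f : 'M_(sz Y, sz X)) :
  chain f -> ind_map (cl f : hom X Y) = cl (mp f).
Proof.
move=> cf; apply: htp_cls.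
have mpB (u v : 'M_(sz Y, sz X)) : mp u - mp v = mp (u - v).
  by rewrite addrC -[- mp v]scaleN1r -mp_linear scaleN1r addrC.
rewrite mpB; apply/mp_htp/cls_htp => //; first exact: rep_chain.
exact: repK.
Qed.

Lemma ind_map_id (X : hCat k) : ind_map (idm X) = idm (ob X : hCat k).
Proof. by rewrite idm_cl ind_map_cl ?mp1 //; exact: chain1. Qed.

Lemma ind_map_comp (X Y Z : hCat k) (g : hom Y Z) (f : hom X Y) :
  ind_map (g \oc f) = ind_map g \oc ind_map f.
Proof.
have [g' cg ->] := clP g; have [f' cf ->] := clP f.
rewrite comp_cl // !ind_map_cl //; last exact: chainM.
by rewrite mpM // comp_cl //; apply: mp_chain.
Qed.

Lemma ind_map_linear (X Y : hCat k) : linear (@ind_map X Y).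
Proof.
move=> a u v; have [u' cu ->] := clP u; have [v' cv ->] := clP v.
rewrite /cl -cls_linear !ind_map_cl //; last by apply: chainD => //; apply: chainZ.
by rewrite mp_linear /cl cls_linear.
Qed.

Definition indF : linFunctor (hCat k) (hCat k) :=
  LinFunctor ind_map_id ind_map_comp ind_map_linear.

Lemma fmap_indF_cl (X Y : hCat k) (f : 'M_(sz Y, sz X)) :
  chain f -> fmap indF (cl f : hom X Y) = cl (mp f).
Proof. exact: ind_map_cl. Qed.
End InducedFunctor.

Section Triangles.
Variable k : fieldType.
Implicit Types X Y Z W : hCat k.

Definition shC (l : int) (X : cplx k) : cplx k.
Proof.
refine (@Cplx k (sz X) (gr_shift l (@gd k X)) (- df X) _ _ _).
- exact/homogN/homog_shift/df_homog.
- by rewrite mulmxN mulNmx opprK df_sq.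
- by move=> i j ij; rewrite mxE df_tri ?oppr0.
Defined.

Lemma shC_chain l X Y (f : 'M[k]_(sz Y, sz X)) :
  chain f -> @chain k (shC l X) (shC l Y) f.
Proof.
by move=> [hf cf]; split; [exact/homog_shift | rewrite /= mulmxN mulNmx cf].
Qed.

Lemma shC_htp l X Y (f : 'M[k]_(sz Y, sz X)) :
  htp f -> @htp k (shC l X) (shC l Y) f.
Proof.
move=> [h hh ->]; exists (- h); last by rewrite /= !mulmxN !mulNmx !opprK.
exact/homogN/homog_shift.
Qed.

Lemma chain_shC l X Y (f : 'M[k]_(sz Y, sz X)) :
  @chain k (shC l X) (shC l Y) f -> chain f.
Proof.
move=> [/homog_shift hf cf]; split => //; apply: oppr_inj.
by move: cf; rewrite /= mulmxN mulNmx.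
Qed.

Lemma htp_shC l X Y (f : 'M[k]_(sz Y, sz X)) :
  @htp k (shC l X) (shC l Y) f -> htp f.
Proof.
move=> [h /homog_shift hh ->]; exists (- h); first exact: homogN.
by rewrite /= !mulmxN !mulNmx.
Qed.

Definition shF (l : int) : linFunctor (hCat k) (hCat k) :=
  @indF k (shC l) (fun X Y f => f) (fun _ _ _ _ _ => erefl) (fun _ => erefl)
    (fun _ _ _ _ _ _ _ => erefl) (@shC_chain l) (@shC_htp l).

Lemma fmap_shF l X Y (f : 'M[k]_(sz Y, sz X)) :
  chain f -> fmap (shF l) (cl f : hom X Y) = cl (f : 'M_(sz (shC l Y), sz (shC l X))).
Proof. exact: fmap_indF_cl. Qed.

Lemma shF_invol_chain a b X : a + b = 0 ->
  @chain k (shC a (shC b X)) X 1%:M /\ @chain k X (shC a (shC b X)) 1%:M.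
Proof.
move=> ab; split; (split; last by rewrite /= opprK mulmx1 mul1mx);
  by apply: homog1 => i; rewrite /= /gr_shift /= -addrA (addrC b) ab addr0 -surjective_pairing.
Qed.

Definition shF_inv a b (ab : a + b = 0) : natIso (compF (shF a) (shF b)) (idF (hCat k)).
Proof.
refine (@NatIso k (hCat k) (hCat k) (compF (shF a) (shF b)) (idF (hCat k))
  (fun X => @cl k (shC a (shC b X)) X 1%:M) _ _).
- move=> X; have [c1 c2] := shF_invol_chain X ab.
  by apply: (is_iso_cl1 c1 c2); rewrite mulmx1.
- move=> X Y f; have [f' cf ->] := clP f.
  have [cX _] := shF_invol_chain X ab; have [cY _] := shF_invol_chain Y ab.
  rewrite /= !ind_map_cl //; do ?[exact: shC_chain|exact: shC_htp].
  rewrite !comp_cl //; first by rewrite mulmx1 mul1mx.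
  exact/shC_chain/shC_chain.
Defined.


Lemma homog_shr e m n (g : 'I_m -> grade) (h : 'I_n -> grade) (M : 'M[k]_(m, n)) :
  homog (e - 1) g h M -> homog e g (gr_shift (-1) h) M.
Proof.
move=> hM i j ne; apply: hM; apply: contra ne => /andP[/eqP d p].
by rewrite /grade_rel /= p andbT d addrAC addrA.
Qed.

Lemma homog_shl e m n (g : 'I_m -> grade) (h : 'I_n -> grade) (M : 'M[k]_(m, n)) :
  homog (e + 1) g h M -> homog e (gr_shift (-1) g) h M.
Proof.
move=> hM i j ne; apply: hM; apply: contra ne => /andP[/eqP d p].
by rewrite /grade_rel /= p andbT d !addrA addrK.
Qed.

Definition blockE := (@mulmx_block, @mul_block_col, @mul_row_block, @mul_row_col, @mul_col_row,
  @mul_mx_row, @mul_col_mx).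
Definition blockD := (@add_block_mx, @add_row_mx, @add_col_mx, @opp_block_mx, @opp_row_mx,
  @opp_col_mx).
Definition mxsimp := (@mulmx0, @mul0mx, @mulmx1, @mul1mx, @mulmxN, @mulNmx,
  @addr0, @add0r, @oppr0, @opprK).

Section Cone.
Variables (X Y : cplx k) (f : 'M[k]_(sz Y, sz X)).

Definition coneC (cf : chain f) : cplx k.
Proof.
refine (@Cplx k (sz Y + sz X) (gr_cat (@gd k Y) (gr_shift (-1) (@gd k X)))
  (block_mx (df Y) f 0 (- df X)) _ _ _).
- case: cf => hf _; apply: homog_block.
  + exact: df_homog.
  + exact: homog_shr.
  + exact: homog0.
  + exact: (@df_homog k (shC (-1) X)).
- rewrite mulmx_block !mxsimp !df_sq; case: cf => _ ->.
  by rewrite subrr block_mx0.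
- move=> i j; case: (split_ordP i) => a ->; case: (split_ordP j) => b -> /=.
  + by rewrite block_mxEul; apply: df_tri.
  + by move=> /(leq_trans (leq_addr _ _)); rewrite leqNgt ltn_ord.
  + by rewrite block_mxEdl mxE.
  + by rewrite block_mxEdr leq_add2l mxE => /df_tri ->; rewrite oppr0.
Defined.

Variable cf : chain f.

Definition cone_in : 'M[k]_(sz (coneC cf), sz Y) := col_mx 1%:M 0.
Definition cone_out : 'M[k]_(sz (shC (-1) X), sz (coneC cf)) := row_mx 0 1%:M.

Lemma cone_in_chain : @chain k Y (coneC cf) cone_in.
Proof.
split; first by apply: homog_col; [exact: homog1 | exact: homog0].
by rewrite blockE !mxsimp blockE !mxsimp.
Qed.

Lemma cone_out_chain : @chain k (coneC cf) (shC (-1) X) cone_out.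
Proof.
split; first by apply: homog_row; [exact: homog0 | exact: homog1].
by rewrite blockE !mxsimp blockE !mxsimp.
Qed.

Definition cin : hom (Y : hCat k) (coneC cf : hCat k) := cl cone_in.
Definition cout : hom (coneC cf : hCat k) (shC (-1) X : hCat k) := cl cone_out.

Lemma cout_cin : cout \oc cin = 0.
Proof.
rewrite comp_cl; [|exact: cone_out_chain|exact: cone_in_chain].
by rewrite blockE !mxsimp; apply: cls0.
Qed.

Lemma cin_f : cin \oc cl f = 0.
Proof.
rewrite comp_cl //; last exact: cone_in_chain.
apply: htp_cls0; exists (col_mx 0 1%:M).
  apply: homog_col; first exact: homog0.
  by apply: homog_shl; exact: homog1.
by rewrite !blockE !mxsimp blockD !mxsimp addNr.
Qed.

Lemma cone_extends W (u : hom (coneC cf : hCat k) W) :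
  u \oc cin = 0 -> exists v, u = v \oc cout.
Proof.
have [u' cu ->] := clP u; rewrite comp_cl //; last exact: cone_in_chain.
move/cls0_htp; case; first by apply: chainM => //; exact: cone_in_chain.
move: cu; rewrite -[u']hsubmxK; set u1 := lsubmx u'; set u2 := rsubmx u'.
rewrite blockE !mxsimp => -[hu cu] h hh eu1.
have /eq_row_mx [eq1 eq2] : row_mx (df W *m u1) (df W *m u2) =
    row_mx (u1 *m df Y) (u1 *m f - u2 *m df X).
  by rewrite -mul_mx_row cu /= mul_row_block !mxsimp.
have hu2 : homog 0 (@gd k W) (@gd k (shC (-1) X)) u2.
  by move=> i j; have := hu i (rshift _ j); rewrite /= gr_catr row_mxEr.
have cv : @chain k (shC (-1) X) W (u2 - h *m f).
  split; first apply: homogD => //.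
    by apply/homogN/homog_shr; apply: (homogM hh cf.1).
  rewrite mulmxBr eq2 mulmxBl /= !mxsimp -[h *m f *m _]mulmxA -cf.2 eu1 mulmxDl !mulmxA.
  by rewrite addrAC [X in X - _]addrC addKr addrC.
exists (@cl k (shC (-1) X) W (u2 - h *m f)); rewrite comp_cl //; last exact: cone_out_chain.
apply: htp_cl; exists (row_mx h 0).
  by apply: homog_row => //; exact: homog0.
by rewrite /= !blockE !mxsimp !blockD !mxsimp eu1 subKr.
Qed.

Lemma cone_lifts W (u : hom W (coneC cf : hCat k)) :
  cout \oc u = 0 -> exists v, u = cin \oc v.
Proof.
have [u' cu ->] := clP u; rewrite comp_cl //; last exact: cone_out_chain.
move/cls0_htp; case; first by apply: chainM => //; exact: cone_out_chain.
move: cu; rewrite -[u']vsubmxK; set u1 := usubmx u'; set u2 := dsubmx u'.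
rewrite blockE !mxsimp => -[hu cu] h hh eu2.
have /eq_col_mx [eq1 eq2] : col_mx (df Y *m u1 + f *m u2) (- (df X *m u2)) =
    col_mx (u1 *m df W) (u2 *m df W).
  by rewrite -mul_col_mx -cu /= mul_block_col !mxsimp.
have hu1 : homog 0 (@gd k Y) (@gd k W) u1.
  by move=> i j; have := hu (lshift _ i) j; rewrite /= gr_catl col_mxEu.
have hh' : homog 0 (@gd k X) (@gd k W) h.
  move=> i j ne; apply: hh; apply: contra ne => /andP[/eqP /= d p].
  by rewrite /grade_rel p andbT -(inj_eq (addIr (-1))) d addr0.
have cv : @chain k W Y (u1 - f *m h).
  split; first by apply: homogD => //; apply/homogN/(homogM cf.1 hh').
  rewrite mulmxBr mulmxA cf.2 mulmxBl -eq1 -addrA; congr (_ + _).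
  by rewrite eu2 /= mulmxDr !mulNmx mulmxN !mulmxA addrK.
exists (@cl k W Y (u1 - f *m h)); rewrite comp_cl //; last exact: cone_in_chain.
apply: htp_cl; exists (col_mx 0 h).
  by apply: homog_col => //; exact: homog0.
by rewrite /= !blockE !mxsimp !blockD !mxsimp eu2 subKr /= mulNmx.
Qed.
End Cone.
End Triangles.

(** * The triangulated structure *)

Section LinCatTheory.
Variables (k : fieldType) (C : linCat k).
Implicit Types X Y Z : C.

Lemma compDl X Y Z (g1 g2 : hom Y Z) (f : hom X Y) :
  (g1 + g2) \oc f = g1 \oc f + g2 \oc f.
Proof. by have := comp_linearl f 1 g1 g2; rewrite !scale1r. Qed.

Lemma compDr X Y Z (g : hom Y Z) (f1 f2 : hom X Y) :
  g \oc (f1 + f2) = g \oc f1 + g \oc f2.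
Proof. by have := comp_linearr g 1 f1 f2; rewrite !scale1r. Qed.

Lemma comp0l X Y Z (f : hom X Y) : (0 : hom Y Z) \oc f = 0.
Proof. by apply: (addrI (0 \oc f)); rewrite -compDl !addr0. Qed.

Lemma comp0r X Y Z (g : hom Y Z) : g \oc (0 : hom X Y) = 0.
Proof. by apply: (addrI (g \oc 0)); rewrite -compDr !addr0. Qed.

Lemma compNl X Y Z (g : hom Y Z) (f : hom X Y) : (- g) \oc f = - (g \oc f).
Proof. by apply: (addrI (g \oc f)); rewrite -compDl !subrr comp0l. Qed.

Lemma compNr X Y Z (g : hom Y Z) (f : hom X Y) : g \oc (- f) = - (g \oc f).
Proof. by apply: (addrI (g \oc f)); rewrite -compDr !subrr comp0r. Qed.

Lemma iso_idm X : is_iso (idm X).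
Proof. by exists (idm X); rewrite comp1m. Qed.

Lemma iso_comp X Y Z (g : hom Y Z) (f : hom X Y) :
  is_iso g -> is_iso f -> is_iso (g \oc f).
Proof.
move=> [g' [g1 g2]] [f' [f1 f2]]; exists (f' \oc g'); split.
  by rewrite -compmA (compmA g') g1 comp1m.
by rewrite -compmA (compmA f) f2 comp1m.
Qed.

Lemma iso_inv X Y (f : hom X Y) :
  is_iso f -> exists g : hom Y X, [/\ is_iso g, g \oc f = idm X & f \oc g = idm Y].
Proof. by move=> [g [gf fg]]; exists g; split=> //; exists f. Qed.

Lemma iso_two_sided X Y (f : hom X Y) (l r : hom Y X) :
  is_iso (l \oc f) -> is_iso (f \oc r) -> is_iso f.
Proof.
move=> [a [a1 _]] [b [_ b2]]; exists (a \oc l).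
have e : a \oc l = r \oc b.
  by rewrite -[LHS]compm1 -b2 !compmA -(compmA a) a1 comp1m.
by split; [rewrite -compmA | rewrite e compmA].
Qed.

Lemma unipotent_iso X (c : hom X X) :
  (c - idm X) \oc (c - idm X) = 0 -> is_iso c.
Proof.
set u := c - idm X => u0; have -> : c = u + idm X by rewrite subrK.
exists (idm X - u); rewrite !(compDl, compDr, compNl, compNr, comp1m, compm1, u0).
by rewrite oppr0 !addr0 add0r; split; [rewrite addrAC subrr add0r | rewrite addrC subrK].
Qed.
End LinCatTheory.

Section FunctorTheory.
Variables (k : fieldType) (C D : linCat k) (F : linFunctor C D).

Lemma fmapD (X Y : C) (f g : hom X Y) : fmap F (f + g) = fmap F f + fmap F g.
Proof. by have := fmap_linear F 1 f g; rewrite !scale1r. Qed.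

Lemma fmap0 (X Y : C) : fmap F (0 : hom X Y) = 0.
Proof. by apply: (addrI (fmap F 0)); rewrite -fmapD !addr0. Qed.

Lemma fmap_iso (X Y : C) (f : hom X Y) : is_iso f -> is_iso (fmap F f).
Proof.
by move=> [g [gf fg]]; exists (fmap F g); rewrite -!fmap_comp gf fg !fmap_id.
Qed.
End FunctorTheory.

Section Triangulation.
Variable k : fieldType.
Notation S := (shF k (-1)).
Implicit Types X Y Z W : hCat k.

Definition hdist X Y Z (f : hom X Y) (g : hom Y Z) (h : hom Z (S X)) : Prop :=
  exists (f0 : 'M[k]_(sz Y, sz X)) (cf : chain f0) (c : hom (coneC cf : hCat k) Z),
    [/\ f = cl f0, is_iso c, c \oc cin cf = g & h \oc c = cout cf].

Lemma fmap_S X Y (f : 'M[k]_(sz Y, sz X)) :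
  chain f -> fmap S (cl f : hom X Y) = @cl k (S X) (S Y) f.
Proof. exact: fmap_shF. Qed.

Lemma S_full X Y (f : hom (S X) (S Y)) : exists g : hom X Y, f = fmap S g.
Proof.
have [f' cf ->] := clP f; have cf' := chain_shC cf.
by exists (@cl k X Y f'); rewrite fmap_S.
Qed.

Lemma S_faithful X Y (f g : hom X Y) : fmap S f = fmap S g -> f = g.
Proof.
have [f' cf ->] := clP f; have [g' cg ->] := clP g.
rewrite !fmap_S // => /cls_htp H; apply/htp_cl/(@htp_shC k (-1)).
by apply: H; apply: shC_chain.
Qed.

Lemma hdist_cone X Y (f : 'M[k]_(sz Y, sz X)) (cf : chain f) :
  @hdist X Y (coneC cf) (cl f) (cin cf) (cout cf).
Proof. by exists f, cf, (idm _); rewrite comp1m compm1; split=> //; apply: iso_idm. Qed.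

Lemma h_tr1_cone X Y (f : hom X Y) :
  exists (Z : hCat k) (g : hom Y Z) (h : hom Z (S X)), hdist f g h.
Proof.
by have [f' cf ->] := clP f; exists (coneC cf), (cin cf), (cout cf); apply: hdist_cone.
Qed.

Lemma hdist_hg X Y Z (f : hom X Y) (g : hom Y Z) (h : hom Z (S X)) :
  hdist f g h -> h \oc g = 0.
Proof. by move=> [f0 [cf [c [_ _ <- hc]]]]; rewrite compmA hc cout_cin. Qed.

Lemma hdist_extends X Y Z W (f : hom X Y) (g : hom Y Z) (h : hom Z (S X)) (u : hom Z W) :
  hdist f g h -> u \oc g = 0 -> exists v, u = v \oc h.
Proof.
move=> [f0 [cf [c [_ [d [dc cd]] <- hc]]]]; rewrite compmA => /cone_extends [v e].
by exists v; rewrite -[LHS]compm1 -cd compmA e -hc -!compmA cd compm1.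
Qed.

Lemma hdist_lifts X Y Z W (f : hom X Y) (g : hom Y Z) (h : hom Z (S X)) (u : hom W Z) :
  hdist f g h -> h \oc u = 0 -> exists v, u = g \oc v.
Proof.
move=> [f0 [cf [c [_ [d [dc cd]] <- hc]]]] hu.
have /cone_lifts [v e] : cout cf \oc (d \oc u) = 0.
  by rewrite -hc -compmA (compmA c) cd comp1m.
by exists v; rewrite -compmA -e compmA cd comp1m.
Qed.

Lemma cone_map X Y X' Y' (f : 'M[k]_(sz Y, sz X)) (f' : 'M[k]_(sz Y', sz X'))
    (cf : chain f) (cf' : chain f') (a : hom X X') (b : hom Y Y') :
  b \oc cl f = cl f' \oc a ->
  exists c : hom (coneC cf : hCat k) (coneC cf' : hCat k),
    c \oc cin cf = cin cf' \oc b /\ fmap S a \oc cout cf = cout cf' \oc c.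
Proof.
have [a' ca ->] := clP a; have [b' cb ->] := clP b.
rewrite fmap_S // (comp_cl cb cf) (comp_cl cf' ca) => /cls_htp[||s hs es]; try exact: chainM.
have cc : @chain k (coneC cf) (coneC cf') (block_mx b' s 0 a').
  split.
    apply: homog_block; [exact: cb.1 | exact: homog_shr | exact: homog0 |].
    by apply/homog_shift; exact: ca.1.
  rewrite /= !blockE !mxsimp cb.2 ca.2; congr block_mx.
  rewrite -[b' *m f](subrK (f' *m a')) es.
  by rewrite [RHS]addrAC addrK.
exists (@cl k (coneC cf) (coneC cf') (block_mx b' s 0 a')).
have ci := cone_in_chain cf; have ci' := cone_in_chain cf'.
have co := cone_out_chain cf; have co' := cone_out_chain cf'.
split; first by rewrite !comp_cl // !blockE !mxsimp.
by rewrite !comp_cl ?blockE ?mxsimp //; apply: shC_chain.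
Qed.

Lemma h_tr3 X Y Z X' Y' Z'
    (f : hom X Y) (g : hom Y Z) (h : hom Z (S X))
    (f' : hom X' Y') (g' : hom Y' Z') (h' : hom Z' (S X'))
    (a : hom X X') (b : hom Y Y') :
  hdist f g h -> hdist f' g' h' -> b \oc f = f' \oc a ->
  exists c : hom Z Z', c \oc g = g' \oc b /\ fmap S a \oc h = h' \oc c.
Proof.
move=> [f0 [cf [c [-> [d [dc cd]] <- hc]]]] [f0' [cf' [c' [-> [d' [dc' cd']] <- hc']]]].
move/(cone_map cf cf') => [m [m1 m2]]; exists (c' \oc m \oc d); split.
  by rewrite -!compmA (compmA d) dc comp1m m1.
by rewrite !compmA hc' -m2 -hc -!compmA cd compm1.
Qed.

Lemma hdist_endo_iso X Y Z (f : hom X Y) (g : hom Y Z) (h : hom Z (S X)) (c : hom Z Z) :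
  hdist f g h -> c \oc g = g -> h \oc c = h -> is_iso c.
Proof.
move=> D cg hc; apply: unipotent_iso.
have [|v ev] := hdist_extends (u := c - idm Z) D.
  by rewrite compDl compNl cg comp1m subrr.
have [|w ew] := hdist_lifts (u := c - idm Z) D.
  by rewrite compDr compNr hc compm1 subrr.
by rewrite [X in X \oc _]ev ew -compmA (compmA h) (hdist_hg D) comp0l comp0r.
Qed.

Lemma hdist_iso3 X Y Z X' Y' Z'
    (f : hom X Y) (g : hom Y Z) (h : hom Z (S X))
    (f' : hom X' Y') (g' : hom Y' Z') (h' : hom Z' (S X'))
    (a : hom X X') (b : hom Y Y') (c : hom Z Z') :
  hdist f g h -> hdist f' g' h' -> is_iso a -> is_iso b -> b \oc f = f' \oc a ->
  c \oc g = g' \oc b -> fmap S a \oc h = h' \oc c -> is_iso c.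
Proof.
move=> D D' [a' [a1 a2]] [b' [b1 b2]] e1 e2 e3.
have e1' : b' \oc f' = f \oc a'.
  by rewrite -[LHS]compm1 -a2 !compmA -(compmA b') -e1 compmA b1 comp1m.
have [c' [e2' e3']] := h_tr3 D' D e1'.
apply: (@iso_two_sided _ _ _ _ _ c' c').
  apply: (hdist_endo_iso D).
    by rewrite -compmA e2 compmA e2' -compmA b1 compm1.
  by rewrite compmA -e3' -compmA -e3 compmA -fmap_comp a1 fmap_id comp1m.
apply: (hdist_endo_iso D').
  by rewrite -compmA e2' compmA e2 -compmA b2 compm1.
by rewrite compmA -e3 -compmA -e3' compmA -fmap_comp a2 fmap_id comp1m.
Qed.

Lemma hdist_rep X Y Z (f : 'M[k]_(sz Y, sz X)) (cf : chain f)
    (g : hom Y Z) (h : hom Z (S X)) :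
  hdist (cl f) g h ->
  exists c : hom (coneC cf : hCat k) Z,
    [/\ is_iso c, c \oc cin cf = g & h \oc c = cout cf].
Proof.
move=> D; have D0 := hdist_cone cf.
have e : idm Y \oc cl f = cl f \oc idm X by rewrite comp1m compm1.
have [c [e1 e2]] := h_tr3 D0 D e; exists c; split.
- by apply: (hdist_iso3 D0 D _ _ e e1 e2); apply: iso_idm.
- by rewrite e1 compm1.
- by rewrite -e2 fmap_id comp1m.
Qed.

Lemma h_tr1_iso X Y Z X' Y' Z'
    (f : hom X Y) (g : hom Y Z) (h : hom Z (S X))
    (f' : hom X' Y') (g' : hom Y' Z') (h' : hom Z' (S X'))
    (a : hom X X') (b : hom Y Y') (c : hom Z Z') :
  is_iso a -> is_iso b -> is_iso c ->
  b \oc f = f' \oc a -> c \oc g = g' \oc b -> fmap S a \oc h = h' \oc c ->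
  hdist f g h -> hdist f' g' h'.
Proof.
move=> ia ib ic e1 e2 e3 D.
have [f0 cf ef] := clP f'; have D0 := hdist_cone cf.
rewrite {}ef in e1 *; have [m [m1 m2]] := h_tr3 D D0 e1.
have im := hdist_iso3 D D0 ia ib e1 m1 m2.
have [m' [im' n1 n2]] := iso_inv im.
exists f0, cf, (c \oc m'); split=> //; first exact: iso_comp.
  have [b' [_ b2]] := ib.
  rewrite -[cin cf]compm1 -b2 !compmA -(compmA (c \oc m')) -m1 -!compmA (compmA m') n1.
  by rewrite comp1m (compmA c) e2 -compmA b2 compm1.
by rewrite compmA -e3 -compmA (compmA) m2 -compmA n2 compm1.
Qed.

Lemma h_tr1_id X Z : is_zero_obj Z -> hdist (idm X) (0 : hom X Z) (0 : hom Z (S X)).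
Proof.
move=> zZ; have c1 := chain1 X; exists 1%:M, c1, 0.
have id0 : idm (coneC c1 : hCat k) = 0.
  rewrite idm_cl; apply: htp_cls0; exists (block_mx 0 0 1%:M 0).
    apply: homog_block; try exact: homog0.
    by apply/homog_shl/homog1.
  rewrite /= !blockE !mxsimp !blockD !mxsimp addNr.
  exact: scalar_mx_block.
split; rewrite ?comp0l ?comp0r //.
- exists 0; split; first by rewrite comp0l id0.
  exact: (zZ Z).1.
- by rewrite -[cout c1]compm1 id0 comp0r.
Qed.

Lemma hdist_rotate_cone X Y (f : 'M[k]_(sz Y, sz X)) (cf : chain f) :
  @hdist Y (coneC cf) (S X) (cin cf) (cout cf) (- fmap S (cl f)).
Proof.
have ci := cone_in_chain cf; have co := cone_out_chain cf.
have cii := cone_in_chain ci; have coi := cone_out_chain ci.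
pose c : 'M[k]_(sz (S X), sz (coneC ci)) := row_mx (cone_out cf) 0.
pose s : 'M[k]_(sz (coneC ci), sz (S X)) := col_mx (col_mx 0 1%:M) (- f).
have cc : @chain k (coneC ci) (S X) c.
  split; first by apply: homog_row; [exact: co.1 | exact: homog0].
  rewrite /c [df (coneC ci)]/(block_mx _ _ _ _) blockE co.2 !blockE !mxsimp.
  by [].
have cs : @chain k (S X) (coneC ci) s.
  split.
    apply: homog_col; last by apply/homogN/homog_shift; exact: cf.1.
    by apply: homog_col; [exact: homog0 | exact: homog1].
  by rewrite /s /= /cone_in !blockE !mxsimp !blockD !mxsimp subrr cf.2.
have sc : @cl k (S X) (coneC ci) s \oc @cl k (coneC ci) (S X) c = idm _.
  rewrite comp_cl // idm_cl; apply: htp_cl; exists (block_mx 0 0 (row_mx (-1%:M) 0) 0).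
    apply: homog_block; try exact: homog0.
    apply: homog_row; last exact: homog0.
    by apply/homog_shl/homogN/homog1.
  rewrite /s /c /= /cone_in /cone_out !blockE !mxsimp !blockD !mxsimp.
  rewrite !scalar_mx_block !opp_block_mx !add_block_mx !mxsimp !subrr.
  by rewrite !block_mxEv !row_mx0 !col_mx0.
have cs1 : @cl k (coneC ci) (S X) c \oc @cl k (S X) (coneC ci) s = idm _.
  by rewrite comp_cl // /s /c /cone_out !blockE !mxsimp.
exists (cone_in cf), ci, (@cl k (coneC ci) (S X) c); split=> //.
- by exists (@cl k (S X) (coneC ci) s).
- by rewrite comp_cl // /cone_in blockE !mxsimp.
- have -> : - fmap S (cl f) = cout ci \oc @cl k (S X) (coneC ci) s.
    by rewrite comp_cl // fmap_S // /s /cone_out blockE !mxsimp /cl clsN.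
  by rewrite -compmA sc compm1.
Qed.

Lemma h_tr2_rotate X Y Z (f : hom X Y) (g : hom Y Z) (h : hom Z (S X)) :
  hdist f g h -> hdist g h (- fmap S f).
Proof.
move=> [f0 [cf [c [-> ic cg hc]]]].
apply: (h_tr1_iso (iso_idm Y) ic (iso_idm (S X)) _ _ _ (hdist_rotate_cone cf)).
- by rewrite compm1.
- by rewrite comp1m.
- by rewrite fmap_id comp1m compm1.
Qed.

Lemma h_tr2 X Y Z (f : hom X Y) (g : hom Y Z) (h : hom Z (S X)) :
  hdist f g h <-> hdist g h (- fmap S f).
Proof.
split=> [|/h_tr2_rotate/h_tr2_rotate D]; first exact: h_tr2_rotate.
have [Z' [g' [h' D']]] := h_tr1_cone f.
have D3 := h_tr2_rotate (h_tr2_rotate (h_tr2_rotate D')).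
have e : idm (S Y) \oc (- fmap S f) = (- fmap S f) \oc idm (S X).
  by rewrite comp1m compm1.
have [c [e1 e2]] := h_tr3 D3 D e.
have ic := hdist_iso3 D3 D (iso_idm _) (iso_idm _) e e1 e2.
have [c0 ec] := S_full c; subst c.
have ic0 : is_iso c0.
  have [d [d1 d2]] := ic; have [d0 ed] := S_full d; subst d.
  by exists d0; split; apply: S_faithful; rewrite fmap_comp fmap_id.
apply: (h_tr1_iso (iso_idm X) (iso_idm Y) ic0 _ _ _ D').
- by rewrite comp1m compm1.
- by rewrite compm1; apply: S_faithful; apply: oppr_inj; rewrite fmap_comp -compNr e1 compm1.
- rewrite fmap_id comp1m; apply: S_faithful; apply: oppr_inj.
  by rewrite fmap_comp -compNl -e2 fmap_id comp1m.
Qed.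

Section Octahedron.
Variables (X Y Z : hCat k) (f : 'M[k]_(sz Y, sz X)) (g : 'M[k]_(sz Z, sz Y)).
Variables (cf : chain f) (cg : chain g).
Let cgf : @chain k X Z (g *m f) := chainM cg cf.

Definition oct_u : hom (coneC cf : hCat k) (coneC cgf : hCat k) :=
  @cl k (coneC cf) (coneC cgf) (block_mx g 0 0 1%:M).
Definition oct_v : hom (coneC cgf : hCat k) (coneC cg : hCat k) :=
  @cl k (coneC cgf) (coneC cg) (block_mx 1%:M 0 0 f).

Lemma oct_u_chain : @chain k (coneC cf) (coneC cgf) (block_mx g 0 0 1%:M).
Proof.
split; last by rewrite /= !blockE !mxsimp cg.2.
apply: homog_block; try exact: homog0; first exact: cg.1.
exact: homog1.
Qed.

Lemma oct_v_chain : @chain k (coneC cgf) (coneC cg) (block_mx 1%:M 0 0 f).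
Proof.
split; last by rewrite /= !blockE !mxsimp cf.2.
apply: homog_block; try exact: homog0; first exact: homog1.
apply/homog_shift; exact: cf.1.
Qed.

Lemma oct_triangle :
  hdist oct_u oct_v (fmap S (cin cf) \oc cout cg).
Proof.
have cu := oct_u_chain; have cv := oct_v_chain.
pose c : 'M[k]_(sz (coneC cg), sz (coneC cu)) :=
  row_mx (block_mx 1%:M 0 0 f) (block_mx 0 0 1%:M 0).
pose s : 'M[k]_(sz (coneC cu), sz (coneC cg)) :=
  col_mx (block_mx 1%:M 0 0 0) (block_mx 0 1%:M 0 0).
have cc : @chain k (coneC cu) (coneC cg) c.
  split.
    apply: homog_row; first exact: cv.1.
    apply/homog_shr/homog_block; try exact: homog0.
    exact/homog_shl/homog1.
  rewrite /c /= !blockE !mxsimp !blockD !mxsimp !blockE !mxsimp !blockD !mxsimp cf.2.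
  by rewrite subrr block_mxEh.
have cs : @chain k (coneC cg) (coneC cu) s.
  split.
    apply: homog_col.
      by apply: homog_block; try exact: homog0; exact: homog1.
    apply/homog_shl/homog_block; try exact: homog0.
    exact/homog_shr/homog1.
  rewrite /s /= !blockE !mxsimp !blockD !mxsimp !blockE !mxsimp !blockD !mxsimp.
  by [].
have sc : @cl k (coneC cg) (coneC cu) s \oc @cl k (coneC cu) (coneC cg) c = idm _.
  rewrite comp_cl // idm_cl; apply: htp_cl.
  exists (block_mx 0 0 (block_mx 0 0 0 (-1%:M)) 0).
    apply: homog_block; try exact: homog0.
    apply/homog_shl/homog_block; try exact: homog0.
    exact/homogN/homog1.
  rewrite /s /c /= !blockE !mxsimp !blockD !mxsimp !blockE !mxsimp !blockD !mxsimp.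
  rewrite !scalar_mx_block.
  rewrite addNr !opp_block_mx !add_block_mx !mxsimp !subrr.
  by rewrite !block_mxEv !row_mx0 !col_mx0.
have cs1 : @cl k (coneC cu) (coneC cg) c \oc @cl k (coneC cg) (coneC cu) s = idm _.
  rewrite comp_cl // /s /c !blockE !mxsimp !blockD !mxsimp.
  by rewrite idm_cl [sz (coneC cg)]/(_ + _)%N scalar_mx_block.
exists (block_mx g 0 0 1%:M), cu, (@cl k (coneC cu) (coneC cg) c); split=> //.
- by exists (@cl k (coneC cg) (coneC cu) s).
- rewrite comp_cl //; last exact: cone_in_chain.
  by rewrite /c /cone_in blockE !mxsimp.
- have -> : fmap S (cin cf) \oc cout cg = cout cu \oc @cl k (coneC cg) (coneC cu) s.
    rewrite fmap_S; last exact: cone_in_chain.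
    rewrite !comp_cl //; try exact: cone_out_chain; last exact/shC_chain/cone_in_chain.
    rewrite /s /cone_in /cone_out !blockE !mxsimp block_mxEv row_mx0.
    by [].
  by rewrite -compmA sc compm1.
Qed.
End Octahedron.

Lemma h_tr4 X Y Z X' Y' Z' (f : hom X Y) (g : hom Y Z)
    (f1 : hom Y Z') (f2 : hom Z' (S X))
    (g1 : hom Z X') (g2 : hom X' (S Y))
    (e1 : hom Z Y') (e2 : hom Y' (S X)) :
  hdist f f1 f2 -> hdist g g1 g2 -> hdist (g \oc f) e1 e2 ->
  exists (u : hom Z' Y') (v : hom Y' X'),
    [/\ hdist u v (fmap S f1 \oc g2),
        u \oc f1 = e1 \oc g, e2 \oc u = f2,
        v \oc e1 = g1 & g2 \oc v = fmap S f \oc e2].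
Proof.
have [f0 cf ->] := clP f; have [g0 cg ->] := clP g.
rewrite comp_cl // => /(hdist_rep cf) [a [ia af1 af2]] /(hdist_rep cg) [b [ib bg1 bg2]].
move=> /(hdist_rep (chainM cg cf)) [c [ic ce1 ce2]].
have [a' [ia' aa1 aa2]] := iso_inv ia; have [c' [ic' cc1 cc2]] := iso_inv ic.
have cu := oct_u_chain cf cg; have cv := oct_v_chain cf cg.
exists (c \oc oct_u cf cg \oc a'), (b \oc oct_v cf cg \oc c'); split.
- apply: (h_tr1_iso ia ic ib _ _ _ (oct_triangle cf cg)).
  + by rewrite -!compmA aa1 compm1.
  + by rewrite -!compmA cc1 compm1.
  + by rewrite compmA -fmap_comp af1 -bg2 compmA.
- rewrite -af1 -ce1 -!compmA (compmA a') aa1 comp1m; congr (_ \oc _).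
  rewrite !comp_cl //; try exact: cone_in_chain.
  by rewrite /cone_in blockE !mxsimp mul_col_mx !mxsimp.
- rewrite !compmA ce2 -[f2]compm1 -aa2 compmA af2; congr (_ \oc _).
  rewrite comp_cl //; last exact: cone_out_chain.
  by rewrite /cone_out blockE !mxsimp.
- rewrite -bg1 -ce1 -!compmA (compmA c') cc1 comp1m; congr (_ \oc _).
  rewrite comp_cl //; last exact: cone_in_chain.
  by rewrite /cone_in blockE !mxsimp.
- rewrite !compmA bg2 -[e2]compm1 -cc2 (compmA e2) ce2 compmA; congr (_ \oc _).
  rewrite fmap_S // !comp_cl //; try exact: cone_out_chain; last exact: shC_chain.
  by rewrite /cone_out blockE !mxsimp mul_mx_row !mxsimp.
Qed.

Definition hTri : triCat k :=
  @TriCat k (hCat k) (hCat_additive k) (shF k (-1)) (shF k 1)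
    (shF_inv k (addNr 1)) (shF_inv k (subrr 1)) hdist
    h_tr1_id h_tr1_iso h_tr1_cone h_tr2 h_tr3 h_tr4.
End Triangulation.

(** * Coarsening the filtration *)

Section CoarseningFunctor.
Variables (k : fieldType) (v : 'I_3 -> nat).
Hypothesis v_mono : forall p q : 'I_3, (p <= q)%N -> (v p <= v q)%N.

Definition same_class : rel grade := fun x y => v x.2 == v y.2.
Definition coarsen m n (g : 'I_m -> grade) (h : 'I_n -> grade) (M : 'M[k]_(m, n)) :=
  trunc same_class g h M.

Lemma coarsen1 n (g : 'I_n -> grade) : coarsen g g 1%:M = 1%:M.
Proof.
apply/matrixP=> i j; rewrite !mxE; case: eqP => [->|_]; last by rewrite if_same.
by rewrite /same_class eqxx.
Qed.

Lemma coarsenM e1 e2 m n p (g : 'I_m -> grade) (h : 'I_n -> grade) (l : 'I_p -> grade)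
    (M : 'M[k]_(m, n)) (N : 'M[k]_(n, p)) :
  homog e1 g h M -> homog e2 h l N -> coarsen g l (M *m N) = coarsen g h M *m coarsen h l N.
Proof.
move=> hM hN; apply/matrixP=> i j; rewrite !mxE.
have -> (b : bool) (x : k) : (if b then x else 0) = b%:R * x.
  by case: b; rewrite ?mul1r ?mul0r.
rewrite mulr_sumr; apply: eq_bigr => t _; rewrite !mxE.
have [r1|/hM->] := boolP (grade_rel e1 (g i) (h t)); last by rewrite if_same !(mul0r, mulr0).
have [r2|/hN->] := boolP (grade_rel e2 (h t) (l j)); last by rewrite if_same !mulr0.
have /andP[_ /v_mono p1] := r1; have /andP[_ /v_mono p2] := r2.
have -> : same_class (g i) (l j) = same_class (g i) (h t) && same_class (h t) (l j).
  rewrite /same_class; apply/eqP/andP => [e|[/eqP-> /eqP->]] //.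
  by rewrite !eqn_leq p1 p2 e p2 -e p1.
by case: same_class; case: same_class; rewrite ?(mul0r, mulr0, mul1r).
Qed.

Lemma coarsen_row m n1 n2 (g : 'I_m -> grade) (h1 : 'I_n1 -> grade) (h2 : 'I_n2 -> grade) A B :
  coarsen g (gr_cat h1 h2) (row_mx A B) = row_mx (coarsen g h1 A) (coarsen g h2 B).
Proof.
apply/matrixP=> i j; rewrite mxE.
by case: (split_ordP j) => b ->; rewrite ?gr_catl ?gr_catr ?row_mxEl ?row_mxEr mxE.
Qed.

Lemma coarsen_col m1 m2 n (g1 : 'I_m1 -> grade) (g2 : 'I_m2 -> grade) (h : 'I_n -> grade) A B :
  coarsen (gr_cat g1 g2) h (col_mx A B) = col_mx (coarsen g1 h A) (coarsen g2 h B).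
Proof.
apply/matrixP=> i j; rewrite mxE.
by case: (split_ordP i) => a ->; rewrite ?gr_catl ?gr_catr ?col_mxEu ?col_mxEd mxE.
Qed.

Lemma coarsen_block m1 m2 n1 n2
    (g1 : 'I_m1 -> grade) (g2 : 'I_m2 -> grade)
    (h1 : 'I_n1 -> grade) (h2 : 'I_n2 -> grade) A B C D :
  coarsen (gr_cat g1 g2) (gr_cat h1 h2) (block_mx A B C D) =
  block_mx (coarsen g1 h1 A) (coarsen g1 h2 B) (coarsen g2 h1 C) (coarsen g2 h2 D).
Proof. by rewrite !block_mxEv coarsen_col !coarsen_row. Qed.

Lemma coarsen_linear m n (g : 'I_m -> grade) (h : 'I_n -> grade) : linear (@coarsen m n g h).
Proof. exact: trunc_linear. Qed.

Lemma coarsenN m n (g : 'I_m -> grade) (h : 'I_n -> grade) (M : 'M[k]_(m, n)) :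
  coarsen g h (- M) = - coarsen g h M.
Proof. exact: linearN. Qed.

Lemma coarsenD m n (g : 'I_m -> grade) (h : 'I_n -> grade) (M N : 'M[k]_(m, n)) :
  coarsen g h (M + N) = coarsen g h M + coarsen g h N.
Proof. exact: linearD. Qed.

Lemma coarsen0 m n (g : 'I_m -> grade) (h : 'I_n -> grade) : coarsen g h 0 = 0.
Proof. exact: linear0. Qed.

Definition coarsenC (X : cplx k) : cplx k.
Proof.
refine (@Cplx k (sz X) (@gd k X) (coarsen (@gd k X) (@gd k X) (df X)) _ _ _).
- exact/homog_trunc/df_homog.
- by rewrite -(coarsenM (@df_homog k X) (@df_homog k X)) df_sq coarsen0.
- by move=> i j ij; rewrite mxE df_tri ?if_same.
Defined.

Definition coarsen_map (X Y : cplx k) (f : 'M[k]_(sz Y, sz X)) :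
  'M[k]_(sz (coarsenC Y), sz (coarsenC X)) := coarsen (@gd k Y) (@gd k X) f.

Lemma coarsen_map_comp (X Y Z : cplx k) (g : 'M_(sz Z, sz Y)) (f : 'M_(sz Y, sz X)) :
  chain g -> chain f -> coarsen_map (g *m f) = coarsen_map g *m coarsen_map f.
Proof. by move=> [hg _] [hf _]; apply: (coarsenM hg hf). Qed.

Lemma coarsen_map_chain (X Y : cplx k) (f : 'M_(sz Y, sz X)) :
  chain f -> chain (coarsen_map f).
Proof.
move=> [hf cf]; split; first exact: homog_trunc.
by rewrite -(coarsenM (@df_homog k Y) hf) -(coarsenM hf (@df_homog k X)) cf.
Qed.

Lemma coarsen_map_htp (X Y : cplx k) (f : 'M_(sz Y, sz X)) :
  htp f -> htp (coarsen_map f).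
Proof.
move=> [h hh ->]; exists (coarsen_map h); first exact: homog_trunc.
by rewrite /coarsen_map coarsenD (coarsenM (@df_homog k Y) hh) (coarsenM hh (@df_homog k X)).
Qed.

Definition coarsenF : linFunctor (hCat k) (hCat k) :=
  @indF k coarsenC coarsen_map (fun X Y => @coarsen_linear _ _ _ _) (fun X => coarsen1 _)
    coarsen_map_comp coarsen_map_chain coarsen_map_htp.

Lemma fmap_coarsenF (X Y : hCat k) (f : 'M_(sz Y, sz X)) :
  chain f -> fmap coarsenF (cl f : hom X Y) = cl (coarsen_map f).
Proof. exact: fmap_indF_cl. Qed.

Lemma coarsen_shift_chain (X : cplx k) :
  @chain k (coarsenC (shC (-1) X)) (shC (-1) (coarsenC X)) 1%:M /\
  @chain k (shC (-1) (coarsenC X)) (coarsenC (shC (-1) X)) 1%:M.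
Proof.
by split; (split; first exact: homog1); rewrite mulmx1 mul1mx /= coarsenN.
Qed.

Lemma coarsen_shift_natural (X Y : hCat k) (f : hom X Y) :
  @cl k (coarsenC (shC (-1) Y)) (shC (-1) (coarsenC Y)) 1%:M \oc
    fmap coarsenF (fmap (shF k (-1)) f) =
  fmap (shF k (-1)) (fmap coarsenF f) \oc
    @cl k (coarsenC (shC (-1) X)) (shC (-1) (coarsenC X)) 1%:M.
Proof.
have [f' cf ->] := clP f.
have [cX _] := coarsen_shift_chain X; have [cY _] := coarsen_shift_chain Y.
have cmf := coarsen_map_chain cf.
rewrite (fmap_coarsenF cf) (fmap_S cmf) (fmap_S cf) fmap_coarsenF; last exact: shC_chain.
rewrite !comp_cl ?mulmx1 ?mul1mx //; first exact: shC_chain.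
exact/coarsen_map_chain/shC_chain.
Qed.

Definition coarsen_shift :
  natIso (compF coarsenF (shift (hTri k))) (compF (shift (hTri k)) coarsenF).
Proof.
refine (@NatIso k _ _ (compF coarsenF (shift (hTri k))) (compF (shift (hTri k)) coarsenF)
  (fun X => @cl k (coarsenC (shC (-1) X)) (shC (-1) (coarsenC X)) 1%:M) _ _).
- move=> X; have [c1 c2] := coarsen_shift_chain X.
  by apply: (is_iso_cl1 c1 c2); rewrite mulmx1.
- exact: coarsen_shift_natural.
Defined.

Lemma coarsen_dist (X Y Z : hTri k) (f : hom X Y) (g : hom Y Z) (h : hom Z (shift (hTri k) X)) :
  dist f g h ->
  @dist k (hTri k) _ _ _ (fmap coarsenF f) (fmap coarsenF g) (coarsen_shift X \oc fmap coarsenF h).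
Proof.
move=> [f0 [cf [c [-> ic <- hc]]]].
have cmf := coarsen_map_chain cf.
have ch : @chain k (coneC cmf) (coarsenC (coneC cf)) 1%:M /\
          @chain k (coarsenC (coneC cf)) (coneC cmf) 1%:M.
  split; (split; first exact: homog1);
  by rewrite mulmx1 mul1mx /= coarsen_block coarsen0 coarsenN.
case: ch => ct ct'.
have ci := cone_in_chain cf; have co := cone_out_chain cf.
exists (coarsen_map f0), cmf, (fmap coarsenF c \oc @cl k (coneC cmf) (coarsenC (coneC cf)) 1%:M).
split.
- by rewrite fmap_coarsenF.
- apply: iso_comp; first exact: fmap_iso.
  by apply: (is_iso_cl1 ct ct'); rewrite mulmx1.
- rewrite fmap_comp -compmA; congr (_ \oc _); rewrite fmap_coarsenF //.
  rewrite comp_cl //; last exact: cone_in_chain.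
  rewrite mul1mx; congr cl.
  by rewrite /coarsen_map coarsen_col coarsen1 coarsen0.
- rewrite -!compmA (compmA (fmap coarsenF h)) -fmap_comp hc fmap_coarsenF //.
  rewrite [nat_map coarsen_shift X]/(@cl k (coarsenC (shC (-1) X)) (shC (-1) (coarsenC X)) 1%:M).
  have [cX _] := coarsen_shift_chain X; have cmo := coarsen_map_chain co.
  rewrite compmA (comp_cl cX cmo) (comp_cl (chainM cX cmo) ct) mulmx1 mul1mx; congr cl.
  by rewrite /coarsen_map coarsen_row coarsen1 coarsen0.
Qed.

Definition coarsenE : exactFunctor (hTri k) (hTri k) := ExactFunctor coarsen_dist.
End CoarseningFunctor.

(** * The exceptional sequence *)

Section Generation.
Variable k : fieldType.

Definition stalk (l : int) (p : 'I_3) : cplx k.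
Proof.
refine (@Cplx k 1 (fun=> (l, p)) 0 _ _ _).
- exact: homog0.
- exact: mul0mx.
- by move=> i j _; rewrite mxE.
Defined.

Lemma isomorphic1 (X Y : hCat k) (f : 'M_(sz Y, sz X)) (g : 'M_(sz X, sz Y)) :
  chain f -> chain g -> g *m f = 1%:M -> f *m g = 1%:M -> isomorphic X Y.
Proof. by move=> cf cg e1 e2; exists (cl f); apply: (is_iso_cl1 cf cg). Qed.

Lemma isomorphic_stalk_shift a l p m : a + l = m ->
  isomorphic (shC a (stalk l p) : hCat k) (stalk m p).
Proof.
move=> e; apply: (@isomorphic1 (shC a (stalk l p)) (stalk m p) 1%:M 1%:M);
  rewrite ?mulmx1 //; (split; last by rewrite /= oppr0 mul0mx mulmx0).
- by apply: homog1 => i; rewrite /gr_shift /= -e addrC.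
- by apply: homog1 => i; rewrite /gr_shift /= -e addrC.
Qed.

Lemma stalk_map_chain l (p q : 'I_3) : (p <= q)%N ->
  @chain k (stalk l p) (stalk l q) 1%:M.
Proof.
move=> pq; split; last by rewrite mulmx1 mul1mx.
by move=> i j; rewrite /grade_rel /= addr0 eqxx pq.
Qed.

(* A complex is the cone of a map from the rest of the complex to its first summand. *)
Lemma generated_by_stalks (P : hTri k -> Prop) :
  strictly_full_tri_sub P -> (forall l p, P (stalk l p)) -> forall X, P X.
Proof.
case=> Piso Pzero _ _ Pcone Pst X.
have [n] := ubnP (sz X); elim: n X => // n IH X.
case: X => -[|m] g d hd sd td ltm.
  apply: Pzero => Y; split=> f h.
    have [f' _ ->] := clP f; have [h' _ ->] := clP h.
    by rewrite [f']thinmx0 [h']thinmx0.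
  have [f' _ ->] := clP f; have [h' _ ->] := clP h.
  by rewrite [f']flatmx0 [h']flatmx0.
have {}ltm : (m < n)%N := ltm.
pose r : 'M_(1, m) := ursubmx (d : 'M_(1 + m)).
pose d' : 'M_m := drsubmx (d : 'M_(1 + m)).
pose g' (i : 'I_m) : grade := g (rshift 1 i).
pose g0 := g (@lshift 1 m 0).
have ed : d = block_mx 0 r 0 d' :> 'M_(1 + m).
  rewrite -[LHS](@submxK _ 1 m 1 m); congr block_mx.
    by apply/matrixP=> i j; rewrite !mxE td // !ord1.
  by apply/matrixP=> i j; rewrite !mxE td //= ord1.
have [ed1 ed2] : r *m d' = 0 /\ d' *m d' = 0.
  have : block_mx 0 r 0 d' *m block_mx 0 r 0 d' = 0 :> 'M_(1 + m) by rewrite -ed; exact: sd.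
  rewrite mulmx_block !mxsimp => e.
  have := congr1 (@ursubmx _ 1 m 1 m) e; have := congr1 (@drsubmx _ 1 m 1 m) e.
  rewrite block_mxKur block_mxKdr => -> ->.
  by split; apply/matrixP=> i j; rewrite !mxE.
have hd' : homog 1 (gr_shift 1 g') (gr_shift 1 g') (- d').
  apply/homogN/homog_shift => i j; rewrite /d' !mxE; exact: hd.
have sd' : (- d') *m (- d') = 0 by rewrite mulmxN mulNmx opprK.
have td' (i j : 'I_m) : (j <= i)%N -> (- d') i j = 0.
  by move=> ij; rewrite !mxE td ?oppr0 //= ltnS.
pose X' := Cplx hd' sd' td'; pose S0 := stalk g0.1 g0.2.
have cr : @chain k X' S0 r.
  split; last by rewrite /= mulmxN ed1 mul0mx oppr0.
  move=> i j ne; rewrite /r !mxE; apply: hd; apply: contra ne.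
  rewrite ord1 => /andP[/eqP e le].
  apply/andP; split; last exact: le.
  by rewrite addr0 /= [g0.1]e.
have PX' : P X' by apply: IH.
apply: (Piso _ _ _ (Pcone _ _ _ _ _ _ (hdist_cone cr) PX' (Pst _ _))).
have eg : gr_cat (@gd k S0) (gr_shift (-1) (@gd k X')) =1 g.
  move=> i; case: (split_ordP i) => a ->.
    by rewrite gr_catl /= ord1 -surjective_pairing.
  by rewrite gr_catr /gr_shift /= addrK -surjective_pairing.
apply: (@isomorphic1 (coneC cr) (Cplx hd sd td) 1%:M 1%:M); rewrite ?mulmx1 //.
  by split; [apply: homog1 => i; exact/esym/eg | rewrite mulmx1 mul1mx /= opprK; exact: ed].
by split; [apply: homog1 => i; exact: eg | rewrite mulmx1 mul1mx /= opprK; exact/esym/ed].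
Qed.
End Generation.

Section Exceptional.
Variable k : fieldType.

Definition pos0 : 'I_3 := @Ordinal 3 0 isT.
Definition pos1 : 'I_3 := @Ordinal 3 1 isT.
Definition pos2 : 'I_3 := @Ordinal 3 2 isT.

Definition cone12 : cplx k := coneC (@stalk_map_chain k 0 pos1 pos2 isT).

Definition excE (i : 'I_3) : hTri k :=
  match val i with 0 => stalk k 0 pos0 | 1 => stalk k 0 pos2 | _ => cone12 end.

Lemma excE_generate (X : hTri k) : tri_generated excE X.
Proof.
move=> P sP PE; apply: (generated_by_stalks sP) => l p.
case: (sP) => Piso Pzero Psh Punsh Pcone.
have P1 : P (stalk k 0 pos1).
  have D := hdist_cone (@stalk_map_chain k 0 pos1 pos2 isT).
  have := Pcone _ _ _ _ _ _ (iffLR (tr2 (t := hTri k) _ _ _) D) (PE pos1) (PE pos2).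
  move/Punsh; apply: Piso.
  by exists (nat_map (unshift_shift (hTri k)) (stalk k 0 pos1));
    exact: (@nat_map_iso _ _ _ _ _ (unshift_shift (hTri k)) (stalk k 0 pos1)).
have P0 : P (stalk k 0 p).
  case: p => -[|[|[|//]]] lt.
  - by rewrite (_ : Ordinal lt = pos0); [exact: (PE pos0) | exact: val_inj].
  - by rewrite (_ : Ordinal lt = pos1); [exact: P1 | exact: val_inj].
  - by rewrite (_ : Ordinal lt = pos2); [exact: (PE pos1) | exact: val_inj].
elim/int_ind: l => // n IH.
  by apply: (Piso _ _ _ (Punsh _ IH)); apply: isomorphic_stalk_shift; rewrite -add1n PoszD.
by apply: (Piso _ _ _ (Psh _ IH)); apply: isomorphic_stalk_shift; rewrite -opprD -PoszD.
Qed.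

(* The l-fold shift, with the sign of the differential left free: the sign is irrelevant to
   the vanishing of Hom, and leaving it free avoids tracking the parity of l. *)
Definition sgC (b : bool) (l : int) (X : cplx k) : cplx k.
Proof.
refine (@Cplx k (sz X) (gr_shift (- l) (@gd k X)) ((-1) ^+ b *: df X) _ _ _).
- exact/homogZ/homog_shift/df_homog.
- by rewrite -scalemxAl -scalemxAr df_sq !scaler0.
- by move=> i j ij; rewrite mxE df_tri ?mulr0.
Defined.

Lemma isomorphic_sgC_shift b l a m (X : hCat k) : a - l = - m ->
  isomorphic (shC a (sgC b l X) : hCat k) (sgC (~~ b) m X).
Proof.
move=> e.
have eg i : gr_shift a (gr_shift (- l) (@gd k X)) i = gr_shift (- m) (@gd k X) i.
  by rewrite /gr_shift /= -e [a - l]addrC addrA.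
have ed : - ((-1) ^+ b *: df X) = (-1) ^+ (~~ b) *: df X.
  by case: b; rewrite /= ?expr0 ?expr1 ?scaleN1r ?scale1r ?opprK.
apply: (@isomorphic1 k (shC a (sgC b l X)) (sgC (~~ b) m X) 1%:M 1%:M); rewrite ?mulmx1 //.
  by split; [apply: homog1 => i; exact/esym/eg | rewrite mulmx1 mul1mx /= ed].
by split; [apply: homog1 => i; exact: eg | rewrite mulmx1 mul1mx /= ed].
Qed.

Lemma isomorphic_trans (X Y Z : hCat k) :
  isomorphic X Y -> isomorphic Y Z -> isomorphic X Z.
Proof. by move=> [f If] [g Ig]; exists (g \oc f); apply: iso_comp. Qed.

Lemma isomorphic_fmap (F : linFunctor (hCat k) (hCat k)) (X Y : hCat k) :
  isomorphic X Y -> isomorphic (F X) (F Y).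
Proof. by move=> [f If]; exists (fmap F f); apply: fmap_iso. Qed.

Lemma isomorphic_sgC0 (X : hCat k) : isomorphic X (sgC false 0 X).
Proof.
have eg i : gr_shift (- 0) (@gd k X) i = gd i.
  by rewrite /gr_shift oppr0 addr0 -surjective_pairing.
apply: (@isomorphic1 k X (sgC false 0 X) 1%:M 1%:M); rewrite ?mulmx1 //.
  by split; [apply: homog1 => i; exact: eg | rewrite mulmx1 mul1mx /= expr0 scale1r].
by split; [apply: homog1 => i; exact/esym/eg | rewrite mulmx1 mul1mx /= expr0 scale1r].
Qed.

Lemma isomorphic_shiftz (X : hTri k) l : exists b, @isomorphic k (hCat k) (shiftz X l) (sgC b l X).
Proof.
have H (F : linFunctor (hCat k) (hCat k)) (a : int) (s : nat -> int) :
    s 0%N = 0 -> (forall n, a - s n = - s n.+1) -> (forall Y, F Y = shC a Y) ->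
    forall n, exists b, @isomorphic k (hCat k) (iter n F X) (sgC b (s n) X).
  move=> s0 sS FE; elim=> [|n [b IH]]; first by exists false; rewrite s0; exact: isomorphic_sgC0.
  exists (~~ b); rewrite iterS; apply: isomorphic_trans (isomorphic_fmap F IH) _.
  by rewrite FE; apply: isomorphic_sgC_shift.
case: l => n.
  by apply: (H _ (-1) Posz) => // m; rewrite -opprD -PoszD.
rewrite NegzE; apply: (H _ 1 (fun m => - m%:Z)) => // m.
by rewrite !opprK -PoszD.
Qed.
End Exceptional.

Section Strong.
Variable k : fieldType.

Lemma hom_eq0 (X Y : hCat k) :
  (forall f : 'M_(sz Y, sz X), chain f -> htp f) -> forall f : hom X Y, f = 0.
Proof. by move=> H f; have [f' /H/htp_cls0 e ->] := clP f. Qed.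

Lemma hom_eq0_iso (X Y Y' : hCat k) : isomorphic Y Y' ->
  (forall f : hom X Y', f = 0) -> forall f : hom X Y, f = 0.
Proof.
move=> [u [w [wu _]]] H f.
by rewrite -[f]comp1m -wu -compmA (H (u \oc f)) comp0r.
Qed.

Lemma End_scalar (X : hCat k) (i : 'I_(sz X)) :
  (forall f : 'M_(sz X, sz X), chain f -> f = (f i i)%:M) ->
  (forall f : 'M_(sz X, sz X), htp f -> f = 0) ->
  bijective (fun a : k => a *: idm X).
Proof.
move=> Hc Hh; exists (fun x : hom X X => rep x i i) => [a | x].
  have ca : chain (a%:M : 'M_(sz X)) by rewrite -scalemx1; apply/chainZ/chain1.
  rewrite idm_cl /cl -clsZ scalemx1.
  have /Hh/eqP : htp (rep (cls a%:M : Hm X X) - a%:M).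
    by apply: cls_htp => //; [exact: rep_chain | rewrite repK].
  by rewrite subr_eq0 => /eqP ->; rewrite mxE eqxx.
by rewrite idm_cl /cl -clsZ scalemx1 -Hc ?repK //; exact: rep_chain.
Qed.

Lemma homog_eq0 e m n (g : 'I_m -> grade) (h : 'I_n -> grade) (M : 'M[k]_(m, n)) :
  homog e g h M -> (forall i j, ~~ grade_rel e (g i) (h j)) -> M = 0.
Proof. by move=> hM ne; apply/matrixP=> i j; rewrite hM // mxE. Qed.

Lemma homog_colP e m1 m2 n (g : 'I_(m1 + m2) -> grade) (h : 'I_n -> grade)
    (A : 'M[k]_(m1, n)) (B : 'M[k]_(m2, n)) :
  homog e g h (col_mx A B) ->
  homog e (g \o @lshift m1 m2) h A /\ homog e (g \o @rshift m1 m2) h B.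
Proof.
by move=> H; split=> i j ne; [rewrite -(col_mxEu A B) | rewrite -(col_mxEd A B)]; apply: H.
Qed.

Lemma homog_rowP e m n1 n2 (g : 'I_m -> grade) (h : 'I_(n1 + n2) -> grade)
    (A : 'M[k]_(m, n1)) (B : 'M[k]_(m, n2)) :
  homog e g h (row_mx A B) ->
  homog e g (h \o @lshift n1 n2) A /\ homog e g (h \o @rshift n1 n2) B.
Proof.
by move=> H; split=> i j ne; [rewrite -(row_mxEl A B) | rewrite -(row_mxEr A B)]; apply: H.
Qed.

Section Shifted.
Variables (b : bool) (l : int).
Hypothesis l0 : l != 0.

Lemma grade_rel_shift d p q :
  grade_rel 0 (d - l, q) (d, p) = false.
Proof. by rewrite /grade_rel /= addr0 -subr_eq0 addrC addKr oppr_eq0 (negPf l0). Qed.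

Lemma htp_stalk_stalk p q (f : 'M[k]_(sz (sgC b l (stalk k 0 q)), sz (stalk k 0 p))) :
  chain f -> htp f.
Proof.
move=> [hf _]; rewrite (homog_eq0 hf) => [|i j]; first exact: htp0.
by rewrite /= grade_rel_shift.
Qed.

Lemma htp_stalk_cone p (f : 'M[k]_(sz (sgC b l (cone12 k)), sz (stalk k 0 p))) :
  chain f -> htp f.
Proof.
rewrite -[f](@vsubmxK _ 1 1 1); set f1 := usubmx _; set f2 := dsubmx _.
move=> [/homog_colP [h1 h2] cf].
have f10 : f1 = 0.
  by apply: (homog_eq0 h1) => i j; rewrite /= /gr_shift gr_catl grade_rel_shift.
have f20 : f2 = 0.
  move: cf; rewrite f10 mulmx0 /= scale_block_mx blockE !mxsimp -scalemxAl mul1mx.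
  rewrite -[RHS]col_mx0 => /eq_col_mx [/eqP].
  by rewrite scaler_eq0 signr_eq0 => /eqP.
by rewrite f10 f20 col_mx0; exact: htp0.
Qed.

Lemma htp_cone_stalk q (f : 'M[k]_(sz (sgC b l (stalk k 0 q)), sz (cone12 k))) :
  (pos1 <= q)%N ==> (pos2 <= q)%N ->
  chain f -> htp f.
Proof.
move=> q12.
rewrite -[f](@hsubmxK _ 1 1 1); set f1 := lsubmx _; set f2 := rsubmx _.
move=> [/homog_rowP [h1 h2] cf].
have f10 : f1 = 0.
  by apply: (homog_eq0 h1) => i j; rewrite /= gr_catl grade_rel_shift.
rewrite f10; exists (row_mx f2 0); last first.
  by rewrite /= scaler0 mul0mx add0r blockE !mxsimp.
apply: homog_row; last exact: homog0.
move=> i j ne; apply: h2; apply: contra ne; rewrite /= gr_catr.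
move=> /andP[/eqP e le]; apply/andP; split; last exact: (implyP q12).
by rewrite /= in e *; rewrite e addr0 addrC.
Qed.

Lemma htp_cone_cone (f : 'M[k]_(sz (sgC b l (cone12 k)), sz (cone12 k))) :
  chain f -> htp f.
Proof.
rewrite -[f](@submxK _ 1 1 1 1) block_mxEv.
move: (ulsubmx _) (ursubmx _) (dlsubmx _) (drsubmx _) => A B C D.
move=> [/homog_colP [/homog_rowP [hA hB] /homog_rowP [hC hD]] cf].
have A0 : A = 0.
  by apply: (homog_eq0 hA) => i j; rewrite /= /gr_shift !gr_catl grade_rel_shift.
have D0 : D = 0.
  by apply: (homog_eq0 hD) => i j; rewrite /= /gr_shift !gr_catr grade_rel_shift.
have C0 : C = 0.
  apply: (homog_eq0 hC) => i j; rewrite /= /gr_shift gr_catl gr_catr.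
  by rewrite /grade_rel andbF.
exists (block_mx B 0 0 0); last first.
  by rewrite A0 C0 D0 /= scale_block_mx !blockE !mxsimp !scaler0 mul0mx !blockD !mxsimp -block_mxEv.
rewrite block_mxEv.
have hB' : homog (-1) (gd (c := sgC b l (cone12 k)) \o @lshift 1 1) (fun=> (0, pos2)) B.
  move=> i j ne; apply: hB; apply: contra ne; rewrite /= /gr_shift gr_catl gr_catr.
  move=> /andP[/eqP e le]; apply/andP; split; last by [].
  by rewrite /= in e *; rewrite e addr0 addrC.
move=> i j.
case: (@split_ordP 1 1 i) => i' ->; last first.
  by rewrite (@col_mxEd _ 1 1) (@row_mx0 _ 1 1 1) mxE.
case: (@split_ordP 1 1 j) => j' ->; last by rewrite (@col_mxEu _ 1 1) (@row_mxEr _ 1 1 1) mxE.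
by rewrite (@col_mxEu _ 1 1) (@row_mxEl _ 1 1 1) /= gr_catl; apply: hB'.
Qed.
End Shifted.

Lemma strong_excE (i j : 'I_3) (l : int) : l != 0 ->
  forall f : hom (excE k i) (shiftz (excE k j) l), f = 0.
Proof.
move=> l0; have [b I] := isomorphic_shiftz (excE k j) l.
apply: (hom_eq0_iso I); apply: hom_eq0.
case: i => -[|[|[|//]]] ?; case: j {I} => -[|[|[|//]]] ? /=.
- exact: htp_stalk_stalk.
- exact: htp_stalk_stalk.
- exact: htp_stalk_cone.
- exact: htp_stalk_stalk.
- exact: htp_stalk_stalk.
- exact: htp_stalk_cone.
- by move=> f; apply: htp_cone_stalk.
- by move=> f; apply: htp_cone_stalk.
- exact: htp_cone_cone.
Qed.

Lemma excE_ordered (i j : 'I_3) : (j < i)%N -> forall f : hom (excE k i) (excE k j), f = 0.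
Proof.
move=> ji; apply: hom_eq0.
case: i ji => -[|[|[|//]]] ?; case: j => -[|[|[|//]]] ? //= _ f.
- move=> [hf _]; rewrite (homog_eq0 hf) => [|i j]; first exact: htp0.
  by rewrite /grade_rel andbF.
- rewrite -[f](@hsubmxK _ 1 1 1); move: (lsubmx _) (rsubmx _) => f1 f2.
  move=> [/homog_rowP [h1 h2] cf].
  rewrite (homog_eq0 h1) => [|i j]; last by rewrite /= gr_catl /grade_rel andbF.
  rewrite (homog_eq0 h2) => [|i j]; last by rewrite /= gr_catr /grade_rel andbF.
  by rewrite (@row_mx0 _ 1 1 1); exact: htp0.
- rewrite -[f](@hsubmxK _ 1 1 1); move: (lsubmx _) (rsubmx _) => f1 f2.
  move=> [/homog_rowP [h1 h2] cf].
  have f10 : f1 = 0.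
    move: cf; rewrite /= mul0mx blockE !mxsimp -[LHS]row_mx0.
    by move/eq_row_mx => [_ <-].
  rewrite f10 (homog_eq0 h2) => [|i j]; last by rewrite /= gr_catr /grade_rel.
  by rewrite (@row_mx0 _ 1 1 1); exact: htp0.
Qed.

Lemma End_stalk p : bijective (fun a : k => a *: idm (stalk k 0 p : hCat k)).
Proof.
apply: (@End_scalar (stalk k 0 p) ord0) => f; first by move=> _; apply: mx11_scalar.
by move=> [h hh ->]; rewrite /= mul0mx mulmx0 addr0.
Qed.

Lemma End_cone12 : bijective (fun a : k => a *: idm (cone12 k : hCat k)).
Proof.
apply: (@End_scalar (cone12 k) (@lshift 1 1 0)) => f.
  rewrite -[f](@submxK _ 1 1 1 1).
  move: (ulsubmx _) (ursubmx _) (dlsubmx _) (drsubmx _) => A B C D.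
  move=> [hf cf]; move: hf; rewrite block_mxEv.
  move=> /homog_colP [/homog_rowP [_ hB] /homog_rowP [hC _]].
  have B0 : B = 0.
    by apply: (homog_eq0 hB) => i j; rewrite /= gr_catl gr_catr.
  have C0 : C = 0.
    by apply: (homog_eq0 hC) => i j; rewrite /= gr_catl gr_catr /grade_rel andbF.
  have DA : D = A.
    move: cf; rewrite B0 C0 /= !blockE !mxsimp.
    by move/(@eq_block_mx _ 1 1 1 1) => [].
  rewrite -block_mxEv B0 C0 DA (@block_mxEul _ 1 1 1 1) [LHS]/= (scalar_mx_block 1 1).
  by rewrite -mx11_scalar.
move=> [h hh ->].
move: hh; rewrite -[h](@submxK _ 1 1 1 1) block_mxEv.
move: (ulsubmx _) (ursubmx _) (dlsubmx _) (drsubmx _) => A B C D.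
move=> /homog_colP [/homog_rowP [hA hB] /homog_rowP [hC hD]].
rewrite (homog_eq0 hA) => [|i j]; last by rewrite /= !gr_catl.
rewrite (homog_eq0 hB) => [|i j]; last by rewrite /= gr_catl gr_catr.
rewrite (homog_eq0 hC) => [|i j]; last by rewrite /= gr_catl gr_catr /grade_rel andbF.
rewrite (homog_eq0 hD) => [|i j]; last by rewrite /= !gr_catr.
by rewrite (@row_mx0 _ 1 1 1) (@col_mx0 _ 1 1) mulmx0 mul0mx addr0.
Qed.

Lemma excE_exceptional : full_strong_exceptional (excE k).
Proof.
split; [| exact: strong_excE | exact: excE_ordered | exact: excE_generate].
by case=> -[|[|[|//]]] ? /=; [exact: End_stalk | exact: End_stalk | exact: End_cone12].
Qed.
End Strong.

(** * Two functors *)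

Section TwoFunctors.
Variable k : fieldType.

Definition class01 (p : 'I_3) : nat := (pos2 <= p)%N.

Lemma class01_mono (p q : 'I_3) : (p <= q)%N -> (class01 p <= class01 q)%N.
Proof. by rewrite /class01; case: leqP => // h2 pq; rewrite (leq_trans h2 pq). Qed.

Definition fine (p : 'I_3) : nat := p.

Lemma fine_mono (p q : 'I_3) : (p <= q)%N -> (fine p <= fine q)%N.
Proof. by []. Qed.

Definition F01 : exactFunctor (hTri k) (hTri k) := coarsenE k class01_mono.
Definition Fgr : exactFunctor (hTri k) (hTri k) :=
  coarsenE k fine_mono.

(* On such objects no differential or chain map has a component from P_0 to P_1, the only
   one on which the two functors disagree. *)
Definition separated (X : cplx k) : Prop :=
  forall i, (gd i = (0, pos0) \/ gd i = (-1, pos1)) \/ (gd (c := X) i).2 = pos2.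

Lemma separated_excE i : separated (excE k i).
Proof.
case: i => -[|[|[|//]]] ? i /=; [by left; left | by right |].
case: (@split_ordP 1 1 i) => j ->; first by right; rewrite gr_catl.
by left; right; rewrite gr_catr.
Qed.

Lemma coarsen_separated (X Y : cplx k) e (f : 'M[k]_(sz Y, sz X)) :
  separated X -> separated Y -> 0 <= e -> homog e (@gd k Y) (@gd k X) f ->
  coarsen class01 (@gd k Y) (@gd k X) f = coarsen fine (@gd k Y) (@gd k X) f.
Proof.
move=> sX sY e0 hf; apply/matrixP=> i j; rewrite !mxE.
have [r|/hf->] := boolP (grade_rel e (gd i) (gd j)); last by rewrite !if_same.
congr (if _ then _ else _); move: r; rewrite /same_class /class01 /fine.
case: (sX j) => [[->|->]|->]; case: (sY i) => [[->|->]|->] //=.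
  by rewrite /grade_rel /= add0r => /andP[/eqP e1]; move: e0; rewrite -e1.
by rewrite /grade_rel andbF.
Qed.

Lemma agree_chain (X : cplx k) : separated X ->
  @chain k (F01 X) (Fgr X) 1%:M /\ @chain k (Fgr X) (F01 X) 1%:M.
Proof.
move=> sX; have e := @coarsen_separated _ _ 1 _ sX sX isT (@df_homog k X).
by split; (split; [exact: homog1 | rewrite mulmx1 mul1mx /= e]).
Qed.

Lemma agree_natural (X Y : hCat k) (f : hom X Y) : separated X -> separated Y ->
  @cl k (F01 Y) (Fgr Y) 1%:M \oc fmap F01 f = fmap Fgr f \oc @cl k (F01 X) (Fgr X) 1%:M.
Proof.
move=> sX sY; have [cX _] := agree_chain sX; have [cY _] := agree_chain sY.
have [f' cf ->] := clP f.
have c1 := coarsen_map_chain class01_mono cf.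
have c2 := coarsen_map_chain fine_mono cf.
have -> : fmap F01 (cl f') = cl (coarsen_map class01_mono f') :> hom (F01 X) (F01 Y).
  exact: fmap_coarsenF.
have -> : fmap Fgr (cl f') = cl (coarsen_map fine_mono f') :> hom (Fgr X) (Fgr Y).
  exact: fmap_coarsenF.
rewrite (comp_cl cY c1) (comp_cl c2 cX) mulmx1 mul1mx; congr cl.
exact: (coarsen_separated sX sY (lexx 0) cf.1).
Qed.

Lemma F01_agrees_Fgr :
  restrict F01 (spanned (excE k)) \simeq restrict Fgr (spanned (excE k)).
Proof.
have sepE (X : {X | spanned (excE k) X}) : separated (sval X).
  by case: X => X /= [i ->]; apply: separated_excE.
constructor.
refine (@NatIso k _ _ (restrict F01 (spanned (excE k))) (restrict Fgr (spanned (excE k)))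
  (fun X => @cl k (F01 (sval X)) (Fgr (sval X)) 1%:M) _ _).
- move=> X; have [c1 c2] := agree_chain (sepE X).
  by apply: (is_iso_cl1 c1 c2); rewrite mulmx1.
- move=> X Y f; exact: (@agree_natural (sval X) (sval Y) f (sepE X) (sepE Y)).
Qed.

Lemma F01_differs_Fgr : ~ (F01 \simeq Fgr).
Proof.
move=> [eta].
have ci := @stalk_map_chain k 0 pos0 pos1 isT.
pose X : hCat k := stalk k 0 pos0; pose Y : hCat k := stalk k 0 pos1.
pose t : hom X Y := @cl k X Y 1%:M.
have nat_t := @nat_map_natural _ _ _ _ _ eta X Y t.
have c1 := coarsen_map_chain class01_mono ci.
have e1 : fmap F01 t = cl (coarsen_map class01_mono (1%:M : 'M_(sz Y, sz X))).
  exact: fmap_coarsenF.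
have e2 : fmap Fgr t = 0.
  transitivity (@cl k (Fgr X) (Fgr Y) (coarsen_map fine_mono (1%:M : 'M_(sz Y, sz X)))).
    exact: fmap_coarsenF.
  rewrite (_ : coarsen_map _ _ = 0); first exact: cls0.
  by apply/matrixP=> a b; rewrite !mxE.
have [w [wu _]] := nat_map_iso eta Y.
have : fmap F01 t = 0 by rewrite -[LHS]comp1m -wu -compmA nat_t e2 comp0l comp0r.
rewrite e1 => /cls0_htp - /(_ c1) [h _].
rewrite /= !coarsen0 mul0mx mulmx0 addr0 => /matrixP /(_ 0 0).
by rewrite !mxE /= => /eqP; rewrite oner_eq0.
Qed.
End TwoFunctors.

Theorem corollary5p4 (k : fieldType) :
  exists (T1 T2 : triCat k) (n : nat) (E : 'I_n -> T1),
    full_strong_exceptional E /\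
    exists F G : exactFunctor T1 T2,
      restrict F (spanned E) \simeq restrict G (spanned E) /\ ~ (F \simeq G).
Proof.
exists (hTri k), (hTri k), 3, (excE k); split; first exact: excE_exceptional.
by exists (F01 k), (Fgr k); split; [exact: F01_agrees_Fgr | exact: F01_differs_Fgr].
Qed.
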